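(* Let $\Gamma$ be a $C^2$, strictly convex, $\mathbb{D}_2$-symmetric billiard curve, and let $Z$ be one of its $\mathbb{D}_2$-symmetric $2$-periodic Birkhoff billiard orbits. Let $L=\|Z_{i+1}-Z_i\|$ and $\kappa=\kappa(Z_i)$; both are independent of $i$. Let $s\ge2$ be an integer and $p=2s$. If $\kappa L<2\cos^2(\pi/p)$, then $\Gamma$ admits a non-Birkhoff periodic billiard orbit $z$ of minimal period $p$ and rotation number $\frac12$ whose spatiotemporal symmetry group is $\langle\sigma\rangle$ for a single reflection $\sigma\in\{S,RS\}$. Moreover $z$ is of type V, meaning that $\sigma$ acts both time-preservingly and time-reversingly: $\sigma(z_i)=z_{p/2+i}$ for all $i$, and there is $k$ with $\sigma(z_i)=z_{k-i}$ for all $i$. Finally, there are lifts $x$ of $z$ and $X$ of $Z$ in $\mathbb{X}_{p,s}$ such that $x-X$ changes sign exactly $2$ times per period $p$.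
   Context: $\mathbb{D}_2=\langle R,S\rangle$, where $R$ is rotation by $\pi$ and $S$ is the reflection in the horizontal axis. A billiard curve is a $C^2$ simple closed curve $\Gamma$ bounding a strictly convex domain. It is parametrized counterclockwise by a $1$-periodic $C^2$ immersion $\gamma$ descending to an embedding of $\mathbb{R}/\mathbb{Z}$, and chosen equivariant: $\gamma(x+1/2)=R\gamma(x)$, $\gamma(-x)=S\gamma(x)$. $\kappa$ denotes curvature. A billiard sequence is $z\in\Gamma^{\mathbb{Z}}$ with $z_i\ne z_{i+1}$. It is a billiard orbit if the billiard reflection law holds at every $z_i$. Lifts $x$ satisfy $\gamma(x_i)=z_i$ and $0<x_{i+1}-x_i<1$. $\mathbb{X}_{p,q}=\{x:x_{i+p}=x_i+q\}$. A real sequence $x$ is Birkhoff if $x_i\le x_j+l\Rightarrow x_{i+m}\le x_{j+m}+l$ for all integers; a billiard sequence is Birkhoff iff its lift is. The spatiotemporal symmetry group $H(z)$ consists of all $h\in\mathbb{D}_2$ for which there is $k\in\mathbb{Z}$ with $h(z_i)=z_{k+i}$ for all $i$ (time-preserving) or $h(z_i)=z_{k-i}$ for all $i$ (time-reversing). $Z$ is $\mathbb{D}_2$-symmetric if $H(Z)=\mathbb{D}_2$. *)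

(* Defs.v *)
From Stdlib Require Import Reals ZArith.
From Coquelicot Require Import Coquelicot.
Open Scope R_scope.

Definition pt := (R * R)%type.
Definition psub (u v : pt) : pt := (fst u - fst v, snd u - snd v).
Definition dot (u v : pt) : R := fst u * fst v + snd u * snd v.
Definition cross (u v : pt) : R := fst u * snd v - snd u * fst v.
Definition pnorm (u : pt) : R := sqrt (dot u u).
Definition pscale (a : R) (u : pt) : pt := (a * fst u, a * snd u).
Definition unitv (u : pt) : pt := pscale (/ pnorm u) u.

Record curve := mkCurve { cx : R -> R ; cy : R -> R }.
Definition gam (c : curve) (x : R) : pt := (cx c x, cy c x).
Definition tangent (c : curve) (x : R) : pt := (Derive (cx c) x, Derive (cy c) x).
Definition accel (c : curve) (x : R) : pt :=
  (Derive (Derive (cx c)) x, Derive (Derive (cy c)) x).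

Definition curvature (c : curve) (x : R) : R :=
  cross (tangent c x) (accel c x) / (pnorm (tangent c x)) ^ 3.

Definition C2 (f : R -> R) : Prop :=
  (forall x, ex_derive f x) /\
  (forall x, ex_derive (Derive f) x) /\
  (forall x, continuous (Derive (Derive f)) x).

Inductive D2 := D2id | D2R | D2S | D2RS.
Definition act (h : D2) (u : pt) : pt :=
  match h with
  | D2id => u
  | D2R => (- fst u, - snd u)
  | D2S => (fst u, - snd u)
  | D2RS => (- fst u, snd u)
  end.

(* A D_2-symmetric (equivariant) billiard curve: C^2, 1-periodic immersion
   descending to an embedding of R/Z, counterclockwise and bounding a strictly
   convex domain (every other point lies strictly to the left of each tangent
   line), with gamma(x+1/2) = R gamma(x) and gamma(-x) = S gamma(x). *)
Definition billiard_curve (c : curve) : Prop :=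
  C2 (cx c) /\ C2 (cy c) /\
  (forall x, gam c (x + 1) = gam c x) /\
  (forall x, tangent c x <> (0, 0)) /\
  (forall x y, gam c x = gam c y -> exists n : Z, y = x + IZR n) /\
  (forall x y, (forall n : Z, y <> x + IZR n) ->
     cross (tangent c x) (psub (gam c y) (gam c x)) > 0) /\
  (forall x, gam c (x + 1/2) = act D2R (gam c x)) /\
  (forall x, gam c (- x) = act D2S (gam c x)).

Definition lift_seq (x : Z -> R) : Prop :=
  forall i : Z, 0 < x (i + 1)%Z - x i < 1.

Definition traj (c : curve) (x : Z -> R) : Z -> pt := fun i => gam c (x i).

(* billiard orbit, given through a lift x: reflection law at every z_i
   (incoming and outgoing unit directions have equal tangential components) *)
Definition billiard_orbit (c : curve) (x : Z -> R) : Prop :=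
  lift_seq x /\
  forall i : Z,
    dot (psub (unitv (psub (gam c (x (i + 1)%Z)) (gam c (x i))))
              (unitv (psub (gam c (x i)) (gam c (x (i - 1)%Z)))))
        (tangent c (x i)) = 0.

Definition Birkhoff (x : Z -> R) : Prop :=
  forall i j l m : Z, x i <= x j + IZR l -> x (i + m)%Z <= x (j + m)%Z + IZR l.

Definition inX (p q : Z) (x : Z -> R) : Prop :=
  forall i : Z, x (i + p)%Z = x i + IZR q.

Definition inH (z : Z -> pt) (h : D2) : Prop :=
  exists k : Z, (forall i, act h (z i) = z (k + i)%Z) \/
                (forall i, act h (z i) = z (k - i)%Z).

Definition D2_symmetric (z : Z -> pt) : Prop := forall h, inH z h.

Definition minimal_period (z : Z -> pt) (p : Z) : Prop :=
  (0 < p)%Z /\ (forall i, z (i + p)%Z = z i) /\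
  forall m : Z, (0 < m < p)%Z -> ~ (forall i, z (i + m)%Z = z i).

Definition sign_change_at (d : Z -> R) (i : Z) : Prop :=
  d i <> 0 /\ exists j : Z, (i < j)%Z /\ d j * d i < 0 /\
    forall k : Z, (i < k < j)%Z -> d k = 0.

Definition two_sign_changes (d : Z -> R) (p : Z) : Prop :=
  exists i1 i2 : Z, (0 <= i1 < i2)%Z /\ (i2 < p)%Z /\
    sign_change_at d i1 /\ sign_change_at d i2 /\
    forall i : Z, (0 <= i < p)%Z -> sign_change_at d i -> i = i1 \/ i = i2.

(* Main.v *)
Require Import Defs.
From Stdlib Require Import Reals ZArith Lra Lia Psatz Classical.
From Coquelicot Require Import Coquelicot.
Open Scope R_scope.

(** The orbit [Z] lies on an axis of symmetry, so [X i = y + i/2] with [y] the parameter of a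
    vertex. Look for [x i = y + i/2 + xi i] with [xi] even, [xi (i + s) = - xi i] and
    [0 < xi i < 1/4] for [2 |i| < s]; evenness and antiperiodicity encode type V, and the sign
    pattern of [xi] gives the two sign changes, the minimal period, the exact symmetry group
    and the failure of the Birkhoff property. Since [gamma (x + 1/2) = - gamma x], the
    reflection law becomes an autonomous second-order recurrence for [xi] that is, by strict
    convexity, increasing in the two neighbours. The constants [0] and [1/4] (the other axis)
    solve it, and [kappa L < 1 + cos (pi/s)] says precisely that [e cos (pi i/s)] is a
    subsolution for small [e > 0]; Perron's method then yields a solution between it and
    [1/4]. *)

(** * Plane vectors, antichords and the action of [D2] *)

Definition padd (u v : pt) : pt := (fst u + fst v, snd u + snd v).

(* As [gamma (x + 1/2) = - gamma x], this is [- <u, gamma' y>] for the unit vector [u] of the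
   chord from [y] to [x + 1/2]. *)
Definition antichord_cos (c : curve) (y x : R) : R :=
  dot (unitv (padd (gam c y) (gam c x))) (tangent c y).

(** At [a = 0] the equation says that [rho] fixes [gam c y]: such a [y] is the parameter of a vertex
    on the axis of [rho]. *)
Definition centre (c : curve) (rho : D2) (y : R) : Prop :=
  (rho = D2S \/ rho = D2RS) /\ forall a, gam c (y - a) = act rho (gam c (y + a)).

Lemma dot_act (h : D2) (u v : pt) : dot (act h u) (act h v) = dot u v.
Proof. destruct h; unfold dot; simpl; ring. Qed.

Lemma padd_act (h : D2) (u v : pt) : padd (act h u) (act h v) = act h (padd u v).
Proof. destruct h; unfold padd; simpl; f_equal; ring. Qed.

Lemma pnorm_act (h : D2) (u : pt) : pnorm (act h u) = pnorm u.
Proof. unfold pnorm; now rewrite dot_act. Qed.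

Lemma unitv_act (h : D2) (u : pt) : unitv (act h u) = act h (unitv u).
Proof.
  unfold unitv; rewrite pnorm_act; destruct h; unfold pscale; simpl; f_equal; ring.
Qed.

Lemma dot_R_r (u v : pt) : dot u (act D2R v) = - dot u v.
Proof. unfold dot; simpl; ring. Qed.

Lemma dot_nonneg (u : pt) : 0 <= dot u u.
Proof. unfold dot; nra. Qed.

Lemma dot_pos (u : pt) : u <> (0, 0) -> 0 < dot u u.
Proof.
  destruct u as [u1 u2]; unfold dot; simpl; intros H.
  destruct (Req_dec u1 0) as [->|]; [destruct (Req_dec u2 0) as [->|]|]; [now elim H|nra|nra].
Qed.

Lemma pnorm_sqr (u : pt) : pnorm u * pnorm u = dot u u.
Proof. apply sqrt_sqrt, dot_nonneg. Qed.

Lemma pnorm_pos (u : pt) : u <> (0, 0) -> 0 < pnorm u.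
Proof. intros H; apply sqrt_lt_R0, dot_pos, H. Qed.

(** * Consequences of the symmetries of the curve *)

Lemma gam_half (c : curve) (x : R) :
  billiard_curve c -> gam c (x + 1/2) = act D2R (gam c x).
Proof. intros (_ & _ & _ & _ & _ & _ & H & _); apply H. Qed.

Lemma gam_IZR (c : curve) (x : R) (n : Z) : billiard_curve c -> gam c (x + IZR n) = gam c x.
Proof.
  intros (_ & _ & H & _); revert x; induction n using Z.peano_ind; intros x.
  - now rewrite Rplus_0_r.
  - rewrite succ_IZR, <- Rplus_assoc, H; apply IHn.
  - rewrite <- (IHn x), <- (H (x + IZR (Z.pred n))); f_equal.
    unfold Z.pred; rewrite plus_IZR; ring.
Qed.

Lemma gam_halves (c : curve) (x : R) (n : Z) :
  billiard_curve c ->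
  gam c (x + IZR n / 2) = if Z.even n then gam c x else act D2R (gam c x).
Proof.
  intros Hc.
  destruct (Z.even n) eqn:E.
  - apply Z.even_spec in E; destruct E as [m ->].
    replace (x + IZR (2 * m) / 2) with (x + IZR m) by (rewrite mult_IZR; field).
    now apply gam_IZR.
  - assert (O : Z.odd n = true) by (rewrite <- Z.negb_even, E; reflexivity).
    apply Z.odd_spec in O; destruct O as [m ->].
    replace (x + IZR (2 * m + 1) / 2) with (x + 1/2 + IZR m)
      by (rewrite plus_IZR, mult_IZR; field).
    rewrite gam_IZR by assumption; now apply gam_half.
Qed.

Lemma gam_inj (c : curve) (x y : R) :
  billiard_curve c -> gam c x = gam c y -> exists n : Z, y = x + IZR n.
Proof. intros (_ & _ & _ & _ & H & _); apply H. Qed.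

Lemma ex_derive_cx (c : curve) x : billiard_curve c -> ex_derive (cx c) x.
Proof. intros ((H & _) & _); apply H. Qed.
Lemma ex_derive_cy (c : curve) x : billiard_curve c -> ex_derive (cy c) x.
Proof. intros (_ & (H & _) & _); apply H. Qed.
Lemma ex_derive_cx' (c : curve) x : billiard_curve c -> ex_derive (Derive (cx c)) x.
Proof. intros ((_ & H & _) & _); apply H. Qed.
Lemma ex_derive_cy' (c : curve) x : billiard_curve c -> ex_derive (Derive (cy c)) x.
Proof. intros (_ & (_ & H & _) & _); apply H. Qed.

Lemma Derive_shift (f : R -> R) (a x : R) :
  ex_derive f (x + a) -> Derive (fun t => f (t + a)) x = Derive f (x + a).
Proof.
  intros H; apply is_derive_unique; auto_derive; [assumption|apply Rmult_1_l].
Qed.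

Lemma tangent_half (c : curve) (x : R) :
  billiard_curve c -> tangent c (x + 1/2) = act D2R (tangent c x).
Proof.
  intros Hc; unfold tangent; simpl.
  rewrite <- (Derive_shift (cx c)) by now apply ex_derive_cx.
  rewrite <- (Derive_shift (cy c)) by now apply ex_derive_cy.
  rewrite <- !Derive_opp.
  f_equal; apply Derive_ext; intros t; generalize (gam_half c t Hc); unfold gam; simpl;
    congruence.
Qed.

Lemma tangent_IZR (c : curve) (x : R) (n : Z) :
  billiard_curve c -> tangent c (x + IZR n) = tangent c x.
Proof.
  intros Hc; unfold tangent.
  rewrite <- (Derive_shift (cx c)) by now apply ex_derive_cx.
  rewrite <- (Derive_shift (cy c)) by now apply ex_derive_cy.
  f_equal; apply Derive_ext; intros t; generalize (gam_IZR c t n Hc); unfold gam;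
    congruence.
Qed.

Lemma tangent_halves (c : curve) (x : R) (n : Z) :
  billiard_curve c ->
  tangent c (x + IZR n / 2) = if Z.even n then tangent c x else act D2R (tangent c x).
Proof.
  intros Hc.
  destruct (Z.even n) eqn:E.
  - apply Z.even_spec in E; destruct E as [m ->].
    replace (x + IZR (2 * m) / 2) with (x + IZR m) by (rewrite mult_IZR; field).
    now apply tangent_IZR.
  - assert (O : Z.odd n = true) by (rewrite <- Z.negb_even, E; reflexivity).
    apply Z.odd_spec in O; destruct O as [m ->].
    replace (x + IZR (2 * m + 1) / 2) with (x + 1/2 + IZR m)
      by (rewrite plus_IZR, mult_IZR; field).
    rewrite tangent_IZR by assumption; now apply tangent_half.
Qed.

(** Differentiating the equation of [centre] in [a] brings in a minus sign, which [D2R]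
    expresses. *)
Lemma tangent_reflect (c : curve) (rho : D2) (y a : R) :
  billiard_curve c -> centre c rho y ->
  tangent c (y - a) = act D2R (act rho (tangent c (y + a))).
Proof.
  intros Hc [Hrho Hy].
  assert (E : forall (f : R -> R) e, (forall x, ex_derive f x) ->
     (forall t, f (y - t) = e * f (y + t)) -> Derive f (y - a) = - (e * Derive f (y + a))).
  { intros f e Hf He.
    assert (D : Derive (fun t => f (y - t)) a = Derive (fun t => e * f (y + t)) a)
      by now apply Derive_ext.
    assert (D1 : Derive (fun t => f (y - t)) a = - Derive f (y - a)).
    { apply is_derive_unique; auto_derive; [apply Hf|unfold Rminus; change (fun x => f x) with f; ring]. }
    assert (D2 : Derive (fun t => e * f (y + t)) a = e * Derive f (y + a)).
    { apply is_derive_unique; auto_derive; [apply Hf|change (fun x => f x) with f; ring]. }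
    lra. }
  (* Both reflections are diagonal, so [E] applies to each coordinate with its own sign. *)
  assert (X : exists e1 e2 : R, forall u, act rho u = (e1 * fst u, e2 * snd u)).
  { destruct Hrho as [-> | ->]; [exists 1, (-1)|exists (-1), 1]; intros u; simpl; f_equal; ring. }
  destruct X as (e1 & e2 & He).
  rewrite He; unfold tangent; simpl; f_equal; apply E.
  - intros x; now apply ex_derive_cx.
  - intros t; generalize (Hy t); rewrite He; unfold gam; simpl; congruence.
  - intros x; now apply ex_derive_cy.
  - intros t; generalize (Hy t); rewrite He; unfold gam; simpl; congruence.
Qed.

(** A vanishing sum would make the two points antipodal; by injectivity [x - y + 1/2] would be an
    integer, yet it lies strictly between 0 and 1. *)
Lemma antichord_nonzero (c : curve) (x y : R) :
  billiard_curve c -> Rabs (x - y) < 1/2 -> padd (gam c y) (gam c x) <> (0, 0).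
Proof.
  intros Hc Hxy E.
  assert (G : gam c y = gam c (x + 1/2)).
  { rewrite gam_half by assumption.
    unfold padd in E; injection E; simpl; intros; unfold gam in *; simpl in *; f_equal; lra. }
  apply gam_inj in G; [|assumption]; destruct G as [n Hn].
  apply Rabs_def2 in Hxy.
  assert (0 < IZR n < 1) as [H0 H1] by lra.
  apply lt_IZR in H0; apply lt_IZR in H1; lia.
Qed.

(** The isometry [rho] takes the antichord to its mirror image, while the mirrored parametrization
    runs backwards and flips the tangent. *)
Lemma antichord_cos_reflect (c : curve) (rho : D2) (y a b : R) :
  billiard_curve c -> centre c rho y ->
  antichord_cos c (y - b) (y - a) = - antichord_cos c (y + b) (y + a).
Proof.
  intros Hc Hy; unfold antichord_cos.
  rewrite (tangent_reflect c rho) by assumption.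
  destruct Hy as [_ Hy]; rewrite !Hy, padd_act, unitv_act, dot_R_r, dot_act; reflexivity.
Qed.

Lemma antichord_cos_centre (c : curve) (rho : D2) (y : R) :
  billiard_curve c -> centre c rho y -> antichord_cos c y y = 0.
Proof.
  intros Hc Hy; generalize (antichord_cos_reflect c rho y 0 0 Hc Hy).
  rewrite Rminus_0_r, Rplus_0_r; lra.
Qed.

(** [rho] composed with the half turn is the other reflection, and the curve meets its axis a
    quarter period after [y]. *)
Lemma centre_quarter (c : curve) (rho : D2) (y : R) :
  billiard_curve c -> centre c rho y -> exists rho', centre c rho' (y + 1/4).
Proof.
  intros Hc [Hrho Hy].
  assert (E : forall a, gam c (y + 1/4 - a) = act rho (act D2R (gam c (y + 1/4 + a)))).
  { intros a; replace (y + 1/4 - a) with (y - (a - 1/4)) by ring.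
    rewrite Hy, <- gam_half, <- (gam_IZR c (y + (a - 1/4)) 1) by assumption.
    do 2 f_equal; lra. }
  destruct Hrho as [-> | ->]; [exists D2RS|exists D2S]; (split; [tauto|]);
    intros a; rewrite E; simpl; f_equal; ring.
Qed.

(** * The antichord cosine *)

(** Strict convexity puts the antipode [gam c (y + 1/2)] of [gam c y] strictly to the left of the
    tangent at [x]. *)
Lemma cross_tangent_gam (c : curve) (x y : R) :
  billiard_curve c -> Rabs (x - y) < 1/2 ->
  cross (tangent c x) (padd (gam c y) (gam c x)) < 0.
Proof.
  intros Hc Hxy.
  assert (P : cross (tangent c x) (psub (gam c (y + 1/2)) (gam c x)) > 0).
  { generalize Hc; intros (_ & _ & _ & _ & _ & P & _); apply P.
    intros n E; apply Rabs_def2 in Hxy.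
    assert (0 < IZR n < 1) as [H0 H1] by lra.
    apply lt_IZR in H0; apply lt_IZR in H1; lia. }
  rewrite gam_half in P by assumption.
  revert P; unfold cross, psub, padd; simpl; lra.
Qed.

Lemma is_derive_unitv_dot (u1 u2 w1 w2 : R -> R) (t u1' u2' w1' w2' : R) :
  is_derive u1 t u1' -> is_derive u2 t u2' -> is_derive w1 t w1' -> is_derive w2 t w2' ->
  0 < dot (u1 t, u2 t) (u1 t, u2 t) ->
  is_derive (fun t => dot (unitv (u1 t, u2 t)) (w1 t, w2 t)) t
   ((u1' * w1 t + u1 t * w1' + (u2' * w2 t + u2 t * w2')) / pnorm (u1 t, u2 t)
    - dot (u1 t, u2 t) (w1 t, w2 t) * (u1 t * u1' + u2 t * u2') / (pnorm (u1 t, u2 t) ^ 3)).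
Proof.
  intros U1 U2 W1 W2.
  unfold dot, unitv, pscale, pnorm, dot; simpl; intros D.
  assert (D2 := sqrt_lt_R0 _ D).
  auto_derive.
  - repeat split; try (eexists; eassumption); try assumption; apply Rgt_not_eq; assumption.
  - change (fun x => u1 x) with u1; change (fun x => u2 x) with u2;
      change (fun x => w1 x) with w1; change (fun x => w2 x) with w2.
    rewrite (is_derive_unique _ _ _ U1), (is_derive_unique _ _ _ U2),
      (is_derive_unique _ _ _ W1), (is_derive_unique _ _ _ W2).
    set (d := sqrt _) in *. field; lra.
Qed.

(* The derivative in x is [cross p p' * cross p T / |p|^3] with p the antichord and T the
   tangent at y; both factors are positive by strict convexity. *)
Lemma antichord_cos_lt (c : curve) (y x x' : R) :
  billiard_curve c -> y - 1/2 < x -> x < x' -> x' < y + 1/2 ->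
  antichord_cos c y x < antichord_cos c y x'.
Proof.
  intros Hc H1 H2 H3.
  set (p := fun x => padd (gam c y) (gam c x)).
  apply (incr_function (antichord_cos c y) (y - 1/2) (y + 1/2)
    (fun x => / (pnorm (p x) * dot (p x) (p x)) *
       (cross (p x) (tangent c x) * cross (p x) (tangent c y)))); try assumption.
  - simpl; intros t Ht1 Ht2.
    assert (Hp : p t <> (0, 0)).
    { apply antichord_nonzero; [assumption|apply Rabs_def1; lra]. }
    generalize (pnorm_pos _ Hp) (pnorm_sqr (p t)) (dot_pos _ Hp); intros N1 N2 N3.
    evar_last.
    + apply (is_derive_unitv_dot (fun x => cx c y + cx c x) (fun x => cy c y + cy c x)
      (fun _ => Derive (cx c) y) (fun _ => Derive (cy c) y) t
      (Derive (cx c) t) (Derive (cy c) t) 0 0); [| | | |exact N3]; auto_derive;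
      try (rewrite Rmult_1_l; reflexivity); try exact I; try reflexivity;
        [now apply ex_derive_cx|now apply ex_derive_cy].
    + change (cx c y + cx c t, cy c y + cy c t) with (p t). Show.
      replace (pnorm (p t) ^ 3) with (pnorm (p t) * dot (p t) (p t)) by (rewrite <- N2; ring).
      rewrite <- N2. set (d := pnorm (p t)) in *.
      transitivity ((dot (tangent c t) (tangent c y) * (d * d)
         - dot (p t) (tangent c y) * dot (p t) (tangent c t)) / (d * (d * d))).
      * unfold dot, tangent, p, padd, gam; simpl; field; lra.
      (* Binet-Cauchy identity: [dot T T' * dot p p - dot p T * dot p T' = cross p T * cross p
         T']. *)
      * rewrite N2; unfold dot, cross; simpl; unfold Rdiv; ring.
  - simpl; intros t Ht1 Ht2.
    assert (Ht : Rabs (t - y) < 1/2) by (apply Rabs_def1; lra).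
    assert (Ht' : Rabs (y - t) < 1/2) by (apply Rabs_def1; lra).
    assert (Hp : p t <> (0, 0)) by now apply antichord_nonzero.
    assert (C1 := cross_tangent_gam c t y Hc Ht).
    assert (C2 := cross_tangent_gam c y t Hc Ht').
    apply Rmult_lt_0_compat.
    + apply Rinv_0_lt_compat, Rmult_lt_0_compat; [now apply pnorm_pos|now apply dot_pos].
    + apply Rmult_lt_0_compat; revert C1 C2; unfold p, cross, padd; simpl; lra.
Qed.

Lemma antichord_cos_le (c : curve) (y x x' : R) :
  billiard_curve c -> y - 1/2 < x -> x <= x' -> x' < y + 1/2 ->
  antichord_cos c y x <= antichord_cos c y x'.
Proof.
  intros Hc H1 [H2| ->] H3; [left; now apply antichord_cos_lt|right; reflexivity].
Qed.

(** Both points move linearly, which serves the linearisation at a vertex as well as continuity in a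
    single unknown, including the unknown that faces its own negative. *)
Lemma is_derive_antichord_cos (c : curve) (x0 y0 a b t : R) :
  billiard_curve c -> Rabs ((x0 + t * a) - (y0 + t * b)) < 1/2 ->
  let y := y0 + t * b in
  let x := x0 + t * a in
  let p := padd (gam c y) (gam c x) in
  let p' := padd (pscale b (tangent c y)) (pscale a (tangent c x)) in
  is_derive (fun t => antichord_cos c (y0 + t * b) (x0 + t * a)) t
    ((dot p' (tangent c y) + b * dot p (accel c y)) / pnorm p
     - dot p (tangent c y) * dot p p' / pnorm p ^ 3).
Proof.
  intros Hc Ht y x p p'.
  assert (Hp : p <> (0, 0)) by now apply antichord_nonzero.
  evar_last.
  - apply (is_derive_unitv_dot (fun t => cx c (y0 + t * b) + cx c (x0 + t * a))
      (fun t => cy c (y0 + t * b) + cy c (x0 + t * a))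
      (fun t => Derive (cx c) (y0 + t * b)) (fun t => Derive (cy c) (y0 + t * b)) t
      (b * Derive (cx c) y + a * Derive (cx c) x)
      (b * Derive (cy c) y + a * Derive (cy c) x)
      (b * Derive (Derive (cx c)) y) (b * Derive (Derive (cy c)) y));
      [| | | |exact (dot_pos _ Hp)].
    + auto_derive; [repeat split; now apply ex_derive_cx|].
      rewrite !Rmult_1_l; reflexivity.
    + auto_derive; [repeat split; now apply ex_derive_cy|].
      rewrite !Rmult_1_l; reflexivity.
    + apply (is_derive_comp (Derive (cx c)) (fun t => y0 + t * b)).
      * now apply Derive_correct, ex_derive_cx'.
      * auto_derive; [exact I|ring].
    + apply (is_derive_comp (Derive (cy c)) (fun t => y0 + t * b)).
      * now apply Derive_correct, ex_derive_cy'.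
      * auto_derive; [exact I|ring].
  - change (cx c (y0 + t * b) + cx c (x0 + t * a), cy c (y0 + t * b) + cy c (x0 + t * a))
      with p.
    f_equal.
    + f_equal; unfold dot, p, p', padd, pscale, gam, tangent, accel, x, y; simpl; ring.
Qed.

(** * Linearisation at a vertex and the barriers *)

Lemma pnorm_double (u : pt) : pnorm (padd u u) = 2 * pnorm u.
Proof.
  unfold pnorm at 1; apply sqrt_lem_1;
    [apply dot_nonneg|generalize (sqrt_pos (dot u u)); unfold pnorm; lra|].
  replace (2 * pnorm u * (2 * pnorm u)) with (4 * (pnorm u * pnorm u)) by ring.
  rewrite pnorm_sqr; unfold dot, padd; simpl; ring.
Qed.

Lemma derive_pos_right (f : R -> R) (l : R) :
  is_derive f 0 l -> f 0 = 0 -> 0 < l ->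
  exists e0, 0 < e0 /\ forall e, 0 < e < e0 -> 0 < f e.
Proof.
  intros D F0 Hl; apply is_derive_Reals in D.
  destruct (D l Hl) as [[d Hd] H]; simpl in H.
  exists d; split; [assumption|]; intros e He.
  assert (K : Rabs ((f (0 + e) - f 0) / e - l) < l).
  { apply H; [lra|]; rewrite Rabs_right; lra. }
  rewrite Rplus_0_l, F0 in K; apply Rabs_def2 in K.
  assert (K' : 0 < (f e - 0) / e) by lra.
  replace (f e) with ((f e - 0) / e * e) by (field; lra).
  apply Rmult_lt_0_compat; lra.
Qed.

(** [rho] fixes the radius and reverses the tangent, so the product equals its own negative. *)
Lemma centre_tangent_orthogonal (c : curve) (rho : D2) (y : R) :
  billiard_curve c -> centre c rho y -> dot (gam c y) (tangent c y) = 0.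
Proof.
  intros Hc Hy.
  assert (T := tangent_reflect c rho y 0 Hc Hy).
  destruct Hy as [_ Hy]; specialize (Hy 0).
  rewrite Rminus_0_r, Rplus_0_r in T, Hy.
  assert (E : dot (gam c y) (tangent c y) = - dot (gam c y) (tangent c y)).
  { rewrite Hy at 1; rewrite T at 1; rewrite dot_R_r, dot_act; reflexivity. }
  lra.
Qed.

Lemma gam_nonzero (c : curve) (y : R) : billiard_curve c -> gam c y <> (0, 0).
Proof.
  intros Hc E; apply (antichord_nonzero c y y Hc).
  - rewrite Rminus_diag, Rabs_R0; lra.
  - rewrite E; unfold padd; simpl; f_equal; ring.
Qed.

Lemma tangent_nonzero (c : curve) (y : R) : billiard_curve c -> tangent c y <> (0, 0).
Proof. intros (_ & _ & _ & H & _); apply H. Qed.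

(** The chord to the antipode is twice the radius, and at a vertex the tangent is orthogonal to the
    radius, so the cross product in the curvature becomes a dot product with the radius. *)
Lemma curvature_diameter (c : curve) (rho : D2) (y : R) :
  billiard_curve c -> centre c rho y ->
  curvature c y * pnorm (psub (gam c (y + 1/2)) (gam c y)) =
  - 2 * dot (gam c y) (accel c y) / dot (tangent c y) (tangent c y).
Proof.
  intros Hc Hy.
  assert (O := centre_tangent_orthogonal c rho y Hc Hy).
  assert (P : cross (tangent c y) (padd (gam c y) (gam c y)) < 0).
  { apply cross_tangent_gam; [assumption|rewrite Rminus_diag, Rabs_R0; lra]. }
  assert (N : pnorm (psub (gam c (y + 1/2)) (gam c y)) = 2 * pnorm (gam c y)).
  { rewrite gam_half, <- pnorm_double by assumption.
    unfold pnorm; f_equal; unfold dot, psub, padd; simpl; ring. }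
  rewrite N; unfold curvature.
  assert (G1 := pnorm_pos _ (gam_nonzero c y Hc)).
  assert (T1 := pnorm_pos _ (tangent_nonzero c y Hc)).
  assert (G2 := pnorm_sqr (gam c y)); assert (T2 := pnorm_sqr (tangent c y)).
  rewrite <- T2.
  set (r := pnorm (gam c y)) in *; set (v := pnorm (tangent c y)) in *.
  destruct (gam c y) as [g1 g2]; destruct (tangent c y) as [t1 t2];
    destruct (accel c y) as [a1 a2].
  unfold cross, dot, padd in *; simpl in *.
  (* The tangent is the radius rotated by a quarter turn and rescaled. *)
  assert (X : r * v = g1 * t2 - g2 * t1).
  (* Lagrange's identity with [O] equates the squares; convexity, through [P], fixes the sign. *)
  { apply Rsqr_inj; [nra|lra|unfold Rsqr].
    replace (r * v * (r * v)) with (r * r * (v * v)) by ring.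
    rewrite G2, T2.
    transitivity ((g1 * t2 - g2 * t1) * (g1 * t2 - g2 * t1) + (g1 * t1 + g2 * t2) * (g1 * t1 + g2 * t2));
      [ring|rewrite O; ring]. }
  assert (E1 : r * t1 = - v * g2).
  { apply (Rmult_eq_reg_l r); [|lra].
    transitivity ((r * r) * t1); [ring|]; rewrite G2.
    transitivity (- (r * v) * g2); [rewrite X|ring].
    transitivity (- (g1 * t2 - g2 * t1) * g2 + g1 * (g1 * t1 + g2 * t2)); [ring|rewrite O; ring]. }
  assert (E2 : r * t2 = v * g1).
  { apply (Rmult_eq_reg_l r); [|lra].
    transitivity ((r * r) * t2); [ring|]; rewrite G2.
    transitivity ((r * v) * g1); [rewrite X|ring].
    transitivity ((g1 * t2 - g2 * t1) * g1 + g2 * (g1 * t1 + g2 * t2)); [ring|rewrite O; ring]. }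
  replace ((t1 * a2 - t2 * a1) / (v * (v * (v * 1))) * (2 * r))
    with (2 * ((r * t1) * a2 - (r * t2) * a1) / (v * (v * v))) by (field; lra).
  rewrite E1, E2; field; lra.
Qed.

(* The linearisation of the reflection law at the 2-periodic orbit. *)
Lemma reflection_defect_pos (c : curve) (rho : D2) (y a a' b q : R) :
  billiard_curve c -> centre c rho y ->
  curvature c y * pnorm (psub (gam c (y + 1/2)) (gam c y)) < 1 + q ->
  0 < b -> a + a' = 2 * b * q ->
  exists e0, 0 < e0 /\ forall e, 0 < e < e0 ->
    0 < antichord_cos c (y + e * b) (y + e * a) + antichord_cos c (y + e * b) (y + e * a').
Proof.
  intros Hc Hy Hk Hb Ha.
  assert (O := centre_tangent_orthogonal c rho y Hc Hy).
  assert (G1 := pnorm_pos _ (gam_nonzero c y Hc)).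
  assert (G2 := pnorm_sqr (gam c y)).
  assert (T1 := dot_pos _ (tangent_nonzero c y Hc)).
  rewrite (curvature_diameter c rho) in Hk by assumption.
  assert (N := pnorm_double (gam c y)).
  assert (D : forall a, is_derive
    (fun t => antichord_cos c (y + t * b) (y + t * a)) 0
    (((a + b) * dot (tangent c y) (tangent c y) + 2 * b * dot (gam c y) (accel c y))
       / (2 * pnorm (gam c y)))).
  { intros a0; evar_last.
    - apply is_derive_antichord_cos; [assumption|].
      rewrite !Rmult_0_l, Rminus_diag, Rabs_R0; lra.
    - rewrite !Rmult_0_l, !Rplus_0_r, N.
      replace (dot (padd (gam c y) (gam c y)) (tangent c y)) with 0
        by (revert O; unfold dot, padd; simpl; lra).
      rewrite Rmult_0_l; unfold Rdiv; rewrite Rmult_0_l, Rminus_0_r.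
      f_equal; unfold dot, padd, pscale; simpl; ring. }
  eapply derive_pos_right.
  - apply @is_derive_plus; apply D.
  - rewrite !Rmult_0_l, !Rplus_0_r.
    rewrite !(antichord_cos_centre c rho) by assumption; ring.
  - unfold plus; simpl; rewrite <- Rdiv_plus_distr.
    apply Rdiv_lt_0_compat; [|lra].
    (* Only the sum [a + a'] enters, so the derivative is a positive multiple of [1 + q] minus
       curvature times diameter. *)
    replace (_ + _ + _) with
      (2 * b * ((1 + q) * dot (tangent c y) (tangent c y) + 2 * dot (gam c y) (accel c y)))
      by (replace a' with (2 * b * q - a) by lra; ring).
    apply Rmult_lt_0_compat; [lra|].
    apply (Rmult_lt_compat_r _ _ _ T1) in Hk.
    replace (-2 * dot (gam c y) (accel c y) / dot (tangent c y) (tangent c y) *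
      dot (tangent c y) (tangent c y)) with (- 2 * dot (gam c y) (accel c y)) in Hk
      by (field; lra).
    lra.
Qed.

Lemma antichord_cos_continuous (c : curve) (x0 y0 a b t : R) :
  billiard_curve c -> Rabs ((x0 + t * a) - (y0 + t * b)) < 1/2 ->
  continuous (fun t => antichord_cos c (y0 + t * b) (x0 + t * a)) t.
Proof.
  intros Hc Ht; apply @ex_derive_continuous; eexists; now apply is_derive_antichord_cos.
Qed.

Lemma continuous_eps (f : R -> R) (x : R) :
  continuous f x -> forall e, 0 < e ->
  exists d, 0 < d /\ forall t, Rabs (t - x) < d -> Rabs (f t - f x) < e.
Proof.
  intros H e He.
  destruct (proj1 (filterlim_locally f (f x)) H (mkposreal e He)) as [[d Hd] K].
  exists d; split; [assumption|]; intros t Ht; apply K, Ht.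
Qed.

(* At its top value [y + 1/4] the last variable would face its own antipode; the barrier
   is therefore placed slightly below. *)
Lemma last_barrier (c : curve) (rho : D2) (y : R) :
  billiard_curve c -> centre c rho y ->
  exists b, 0 < b < 1/4 /\
    antichord_cos c (y + b) (y + 1/4) + antichord_cos c (y + b) y < 0.
Proof.
  intros Hc Hy.
  destruct (centre_quarter c rho y Hc Hy) as [rho' Hq].
  set (f := fun t => antichord_cos c (y + t * 1) (y + 1/4 + t * 0)
     + antichord_cos c (y + t * 1) (y + t * 0)).
  assert (C : continuous f (1/4)).
  { apply @continuous_plus; apply antichord_cos_continuous; try assumption;
      apply Rabs_def1; lra. }
  (* At [1/4] the first term vanishes and the second is negative by monotonicity; continuity carries
     the inequality slightly below. *)
  assert (F : f (1/4) < 0).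
  { unfold f; rewrite !Rmult_0_r, !Rplus_0_r, Rmult_1_r.
    rewrite (antichord_cos_centre c rho') by assumption.
    assert (antichord_cos c (y + 1/4) y < antichord_cos c (y + 1/4) (y + 1/4))
      by (apply antichord_cos_lt; [assumption|lra..]).
    rewrite (antichord_cos_centre c rho') in H by assumption; lra. }
  destruct (continuous_eps f (1/4) C (- f (1/4))) as (d & Hd & K); [lra|].
  (* The cap [1/4] on [d] keeps the witness positive. *)
  exists (1/4 - Rmin d (1/4) / 2).
  assert (Rmin d (1/4) <= d) by apply Rmin_l.
  assert (Rmin d (1/4) <= 1/4) by apply Rmin_r.
  assert (0 < Rmin d (1/4)) by (apply Rmin_glb_lt; lra).
  split; [lra|].
  specialize (K (1/4 - Rmin d (1/4) / 2)).
  assert (K' : Rabs (1 / 4 - Rmin d (1 / 4) / 2 - 1 / 4) < d) by (apply Rabs_def1; lra).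
  apply K, Rabs_def2 in K'; unfold f at 1 in K'.
  rewrite !Rmult_0_r, !Rplus_0_r, Rmult_1_r in K'; lra.
Qed.

(** * Perron's method *)

Definition upd (eta : Z -> R) (i : Z) (t : R) (j : Z) : R :=
  if Z.eq_dec j i then t else eta j.

(* The supremum of the subsolutions of a system [F i = 0] that is
   monotone in the off-diagonal variables is a solution. *)
Lemma perron (D : Z -> Prop) (m B : Z -> R) (F : Z -> (Z -> R) -> R) :
  let box eta := forall j, m j <= eta j <= B j in
  (forall j, m j <= B j) ->
  (forall i eta zeta, D i -> box eta -> box zeta -> eta i = zeta i ->
     (forall j, eta j <= zeta j) -> F i eta <= F i zeta) ->
  (forall i eta, D i -> box eta -> forall e, 0 < e -> exists d, 0 < d /\
     forall t, m i <= t <= B i -> Rabs (t - eta i) < d ->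
       Rabs (F i (upd eta i t) - F i eta) < e) ->
  (forall i eta, D i -> box eta -> eta i = B i -> F i eta <= 0) ->
  (forall i, D i -> 0 <= F i m) ->
  exists eta, box eta /\ forall i, D i -> F i eta = 0.
Proof.
  intros box mB mono cont top sub.
  set (A := fun eta => box eta /\ forall i, D i -> 0 <= F i eta).
  assert (Am : A m).
  { split; [intros j; split; [apply Rle_refl|apply mB]|assumption]. }
  assert (bnd : forall j, bound (fun t => exists eta, A eta /\ eta j = t)).
  { intros j; exists (B j); intros t (eta & [H _] & <-); apply H. }
  assert (ne : forall j, exists t, exists eta, A eta /\ eta j = t).
  { intros j; exists (m j), m; now split. }
  set (top_sol := fun j => proj1_sig (completeness _ (bnd j) (ne j))).
  assert (lub : forall j, is_lub (fun t => exists eta, A eta /\ eta j = t) (top_sol j)).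
  { intros j; exact (proj2_sig (completeness _ (bnd j) (ne j))). }
  assert (ub : forall eta, A eta -> forall j, eta j <= top_sol j).
  { intros eta H j; apply (proj1 (lub j)); now exists eta. }
  assert (Hbox : box top_sol).
  { intros j; split; [now apply ub|].
    apply (proj2 (lub j)); intros t (eta & [H _] & <-); apply H. }
  assert (Hupd : forall i t, m i <= t <= B i -> box (upd top_sol i t)).
  { intros i t Ht j; unfold upd; destruct (Z.eq_dec j i) as [->|_]; [assumption|apply Hbox]. }
  assert (upd_same : forall i t, upd top_sol i t i = t).
  { intros i t; unfold upd; destruct (Z.eq_dec i i); [reflexivity|now elim n]. }
  assert (ge0 : forall i, D i -> 0 <= F i top_sol).
  { intros i Hi; apply Rnot_lt_le; intros Hlt.
    destruct (cont i top_sol Hi Hbox (- F i top_sol)) as (d & Hd & K); [lra|].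
    (* Take a subsolution within [d] of the supremum at [i]: raising its other entries to the
       supremum can only increase [F i], and continuity in entry [i] contradicts negativity. If none
       existed, [top_sol i - d] would be a smaller upper bound. *)
    destruct (classic (exists eta, A eta /\ top_sol i - d < eta i))
      as [(eta & Heta & Hlo)|N].
    - assert (Hhi := ub eta Heta i).
      assert (Hr : m i <= eta i <= B i) by apply Heta.
      assert (K' : Rabs (F i (upd top_sol i (eta i)) - F i top_sol) < - F i top_sol).
      { apply K; [assumption|apply Rabs_def1; lra]. }
      apply Rabs_def2 in K'.
      assert (0 <= F i eta) by now apply Heta.
      assert (F i eta <= F i (upd top_sol i (eta i))).
      { apply mono; [assumption|apply Heta|now apply Hupd|now rewrite upd_same|].
        intros j; unfold upd; destruct (Z.eq_dec j i) as [->|_]; [apply Rle_refl|now apply ub]. }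
      lra.
    - assert (top_sol i <= top_sol i - d); [|lra].
      apply (proj2 (lub i)); intros t (eta & Heta & <-).
      apply Rnot_lt_le; intros H; apply N; now exists eta. }
  exists top_sol; split; [assumption|]; intros i Hi.
  destruct (ge0 i Hi) as [Hgt|E]; [|now symmetry].
  assert (HB : top_sol i < B i).
  { destruct (Hbox i) as [_ [H|H]]; [assumption|].
    generalize (top i top_sol Hi Hbox H); lra. }
  destruct (cont i top_sol Hi Hbox (F i top_sol) Hgt) as (d & Hd & K).
  (* Were [F i] positive, entry [i] could be raised a little: [F i] stays nonnegative and the other
     [F j] do not decrease, so a subsolution would exceed the supremum. *)
  set (t := top_sol i + Rmin (d / 2) (B i - top_sol i)).
  assert (Rmin (d / 2) (B i - top_sol i) <= d / 2) by apply Rmin_l.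
  assert (Rmin (d / 2) (B i - top_sol i) <= B i - top_sol i) by apply Rmin_r.
  assert (0 < Rmin (d / 2) (B i - top_sol i)) by (apply Rmin_glb_lt; lra).
  assert (Ht : m i <= t <= B i) by (generalize (Hbox i); unfold t; lra).
  assert (At : A (upd top_sol i t)).
  { split; [now apply Hupd|]; intros j Hj.
    destruct (Z.eq_dec j i) as [->|Hji].
    - assert (K' : Rabs (F i (upd top_sol i t) - F i top_sol) < F i top_sol).
      { apply K; [assumption|unfold t; apply Rabs_def1; lra]. }
      apply Rabs_def2 in K'; lra.
    - apply Rle_trans with (F j top_sol); [now apply ge0|].
      apply mono; [assumption|assumption|now apply Hupd| |].
      + unfold upd; destruct (Z.eq_dec j i); [contradiction|reflexivity].
      + intros k; unfold upd; destruct (Z.eq_dec k i) as [->|_]; [unfold t; lra|apply Rle_refl]. }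
  generalize (ub _ At i); rewrite upd_same; unfold t; lra.
Qed.

(** * The boundary value problem on half a period *)

Lemma uniform_small (P : Z -> R -> Prop) (n : nat) :
  (forall i, (0 <= i < Z.of_nat n)%Z -> exists e0, 0 < e0 /\ forall e, 0 < e < e0 -> P i e) ->
  exists e0, 0 < e0 /\ forall e, 0 < e < e0 -> forall i, (0 <= i < Z.of_nat n)%Z -> P i e.
Proof.
  induction n as [|n IH]; intros H.
  - exists 1; split; [lra|]; intros; lia.
  - destruct IH as (e1 & He1 & K1); [intros i Hi; apply H; lia|].
    destruct (H (Z.of_nat n)) as (e2 & He2 & K2); [lia|].
    exists (Rmin e1 e2); split; [now apply Rmin_glb_lt|]; intros e He i Hi.
    assert (Rmin e1 e2 <= e1) by apply Rmin_l.
    assert (Rmin e1 e2 <= e2) by apply Rmin_r.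
    destruct (Z.eq_dec i (Z.of_nat n)) as [->|Hn]; [apply K2; lra|apply K1; [lra|lia]].
Qed.

(** Minus the imbalance in the reflection law at a bounce with offset [b], whose neighbours have
    offsets [a] and [a'] once the half turns of the 2-periodic orbit are removed. *)
Definition defect (c : curve) (y b a a' : R) : R :=
  antichord_cos c (y + b) (y + a) + antichord_cos c (y + b) (y + a').

(* For [2 i + 1 = s] the antisymmetry axis [s / 2] lies halfway between [i] and [i + 1]. *)
Definition next_value (s : Z) (eta : Z -> R) (i : Z) : R :=
  if Z.eq_dec (2 * i + 1) s then - eta i else eta (i + 1)%Z.

Lemma defect_le (c : curve) (y b a1 a2 a1' a2' : R) :
  billiard_curve c -> b - 1/2 < a1 -> a1 <= a2 -> a2 < b + 1/2 ->
  b - 1/2 < a1' -> a1' <= a2' -> a2' < b + 1/2 ->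
  defect c y b a1 a1' <= defect c y b a2 a2'.
Proof. intros Hc; intros; apply Rplus_le_compat; apply antichord_cos_le; trivial; lra. Qed.

(** The vertex a quarter period away is a centre too, which makes the constant [1/4] a solution and
    a barrier. *)
Lemma antichord_cos_quarter (c : curve) (rho : D2) (y : R) :
  billiard_curve c -> centre c rho y -> antichord_cos c (y + 1/4) (y + 1/4) = 0.
Proof.
  intros Hc Hy; destruct (centre_quarter c rho y Hc Hy) as [rho' Hq].
  now apply (antichord_cos_centre c rho').
Qed.

Lemma cos_pos_half (s i : Z) : (0 <= i)%Z -> (2 * i < s)%Z -> 0 < cos (PI * IZR i / IZR s).
Proof.
  intros H1 H2.
  assert (Hs : 0 < IZR s) by (apply IZR_lt; lia).
  assert (Hi : 0 <= IZR i) by (apply IZR_le; lia).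
  assert (Hi2 : 2 * IZR i < IZR s) by (rewrite <- mult_IZR; now apply IZR_lt).
  assert (Hpi := PI_RGT_0).
  assert (0 <= IZR i / IZR s).
  { apply Rmult_le_pos; [assumption|left; now apply Rinv_0_lt_compat]. }
  assert (IZR i / IZR s < 1 / 2).
  { apply (Rmult_lt_reg_r (IZR s)); [assumption|].
    replace (IZR i / IZR s * IZR s) with (IZR i) by (field; lra); lra. }
  replace (PI * IZR i / IZR s) with (PI * (IZR i / IZR s)) by (field; lra).
  apply cos_gt_0; nra.
Qed.

(** The cosine is an eigenvector of the neighbour sum; the eigenvalue supplies the [q] of
    [reflection_defect_pos]. *)
Lemma cos_neighbours (s i : Z) :
  (0 < s)%Z ->
  cos (PI * IZR (i - 1) / IZR s) + cos (PI * IZR (i + 1) / IZR s) =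
  2 * cos (PI * IZR i / IZR s) * cos (PI / IZR s).
Proof.
  intros Hs; assert (0 < IZR s) by (now apply IZR_lt).
  rewrite plus_IZR, minus_IZR.
  replace (PI * (IZR i - 1) / IZR s) with (PI * IZR i / IZR s - PI / IZR s) by (field; lra).
  replace (PI * (IZR i + 1) / IZR s) with (PI * IZR i / IZR s + PI / IZR s) by (field; lra).
  rewrite cos_minus, cos_plus; ring.
Qed.

(** The unknowns are the entries with [0 <= 2 i < s]. Evenness closes the system at 0 through
    [Z.abs], antiperiodicity at [s / 2] through [next_value], and [perron] applies between a small
    cosine and the upper barrier. *)
Lemma half_period_solution (c : curve) (rho : D2) (y : R) (s : Z) :
  billiard_curve c -> centre c rho y -> (2 <= s)%Z ->
  curvature c y * pnorm (psub (gam c (y + 1/2)) (gam c y)) < 1 + cos (PI / IZR s) ->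
  exists eta : Z -> R,
    (forall i, (0 <= i)%Z -> (2 * i < s)%Z -> 0 < eta i < 1/4) /\
    (forall i, (s <= 2 * i)%Z -> eta i = 0) /\
    (forall i, (0 <= i)%Z -> (2 * i < s)%Z ->
       defect c y (eta i) (eta (Z.abs (i - 1))) (next_value s eta i) = 0).
Proof.
  intros Hc Hy Hs Hk.
  destruct (last_barrier c rho y Hc Hy) as (b & Hb & Hbar).
  assert (Hs0 : 0 < IZR s) by (apply IZR_lt; lia).
  set (w := fun i => cos (PI * IZR i / IZR s)).
  assert (w_le : forall i, w i <= 1) by (intros i; apply COS_bound).
  destruct (uniform_small (fun i e => (2 * i < s)%Z ->
     0 < defect c y (e * w i) (e * w (i - 1)%Z) (e * w (i + 1)%Z)) (Z.to_nat s))
    as (e0 & He0 & K).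
  { intros i Hi; destruct (Z_lt_dec (2 * i) s) as [H2|H2].
    - destruct (reflection_defect_pos c rho y (w (i - 1)%Z) (w (i + 1)%Z) (w i)
        (cos (PI / IZR s)) Hc Hy Hk) as (e0 & He0 & K).
      + apply cos_pos_half; lia.
      + apply cos_neighbours; lia.
      + exists e0; split; [assumption|]; intros e He _; now apply K.
    - exists 1; split; [lra|]; intros; lia. }
  (* Below [e0] the cosine is a subsolution; below [b] it stays under every barrier, since
     [w <= 1]. *)
  set (e := Rmin b e0 / 2).
  assert (Rmin b e0 <= b) by apply Rmin_l.
  assert (Rmin b e0 <= e0) by apply Rmin_r.
  assert (0 < Rmin b e0) by (apply Rmin_glb_lt; lra).
  assert (He : 0 < e < e0) by (unfold e; lra).
  assert (Heb : e < b) by (unfold e; lra).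
  clearbody e.
  set (D := fun i => (0 <= i)%Z /\ (2 * i < s)%Z).
  assert (Ddec : forall i, {D i} + {~ D i}).
  { intros i; unfold D; destruct (Z_le_dec 0 i); destruct (Z_lt_dec (2 * i) s);
      (left; lia) || (right; lia). }
  (* Outside [D] both bounds are 0, which pins those entries, in particular the node [s / 2] for
     even [s]. *)
  set (m := fun i => if Ddec i then e * w i else 0).
  set (B := fun i => if Ddec i then if Z.eq_dec (2 * i + 1) s then b else 1/4 else 0).
  assert (mD : forall i, D i -> m i = e * w i) by (intros i Hi; unfold m; destruct (Ddec i); tauto).
  assert (m0 : forall i, ~ D i -> m i = 0) by (intros i Hi; unfold m; destruct (Ddec i); tauto).
  assert (B0 : forall i, ~ D i -> B i = 0) by (intros i Hi; unfold B; destruct (Ddec i); tauto).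
  assert (Blast : forall i, D i -> (2 * i + 1 = s)%Z -> B i = b).
  { intros i Hi Hi2; unfold B; destruct (Ddec i); [|tauto].
    destruct (Z.eq_dec (2 * i + 1) s); tauto. }
  assert (Bother : forall i, D i -> (2 * i + 1 <> s)%Z -> B i = 1/4).
  { intros i Hi Hi2; unfold B; destruct (Ddec i); [|tauto].
    destruct (Z.eq_dec (2 * i + 1) s); tauto. }
  assert (B4 : forall i, B i <= 1/4).
  { intros i; unfold B; destruct (Ddec i); [destruct Z.eq_dec|]; lra. }
  assert (w_pos : forall i, D i -> 0 < w i) by (intros i [? ?]; now apply cos_pos_half).
  assert (mpos : forall i, D i -> 0 < m i).
  { intros i Hi; rewrite mD by assumption; apply Rmult_lt_0_compat; [lra|auto]. }
  assert (mge : forall i, 0 <= m i).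
  { intros i; destruct (Ddec i) as [Hi|Hi]; [left; auto|rewrite m0 by assumption; lra]. }
  set (F := fun i eta => defect c y (eta i) (eta (Z.abs (i - 1))) (next_value s eta i)).
  assert (mE : forall j, (0 <= j)%Z -> (2 * j <= s)%Z -> m j = e * w j).
  { intros j H1' H2'; destruct (Z.eq_dec (2 * j) s) as [E|E]; [|apply mD; split; lia].
    rewrite m0 by (unfold D; lia).
    replace (w j) with 0; [ring|].
    unfold w; rewrite <- cos_PI2; f_equal.
    replace (IZR s) with (2 * IZR j) in * by (rewrite <- mult_IZR; f_equal; lia).
    field; lra. }
  (* The cosine is even about 0 and odd about [s / 2], so the folded neighbours still sample
     [e * w]. *)
  assert (sub : forall i, D i -> 0 <= F i m).
  { intros i Hi; left; unfold F.
    assert (E1 : m (Z.abs (i - 1)) = e * w (i - 1)%Z).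
    { rewrite mE by (destruct Hi; lia).
      destruct (Z_le_dec 1 i); [now rewrite Z.abs_eq by lia|].
      rewrite Z.abs_neq by lia; unfold w; rewrite opp_IZR.
      replace (PI * - IZR (i - 1) / IZR s) with (- (PI * IZR (i - 1) / IZR s)) by (field; lra).
      now rewrite cos_neg. }
    assert (E2 : next_value s m i = e * w (i + 1)%Z).
    { unfold next_value; destruct (Z.eq_dec (2 * i + 1) s) as [E|E].
      - rewrite mD by assumption.
        replace (w (i + 1)%Z) with (- w i); [ring|].
        unfold w; rewrite <- Rtrigo_facts.cos_pi_minus; f_equal.
        replace (i + 1)%Z with (s - i)%Z by lia; rewrite minus_IZR; field; lra.
      - apply mE; destruct Hi; lia. }
    rewrite E1, E2, mD by assumption; apply K; [assumption|destruct Hi; lia|apply Hi]. }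
  assert (bx : forall eta, (forall j, m j <= eta j <= B j) -> forall j, 0 <= eta j <= 1/4).
  { intros eta H' j; generalize (H' j) (mge j) (B4 j); lra. }
  destruct (perron D m B F) as (eta & Hbox & Hsol).
  - intros j; destruct (Ddec j) as [Hj|Hj]; [|rewrite m0, B0 by assumption; lra].
    rewrite mD by assumption.
    assert (e * w j <= e * 1) by (apply Rmult_le_compat_l; [lra|apply w_le]).
    destruct (Z.eq_dec (2 * j + 1) s); [rewrite Blast by assumption|rewrite Bother by assumption]; lra.
  - intros i eta zeta Hi Heta Hzeta E Hle; unfold F, next_value; rewrite E.
    (* The last unknown faces its own negative, at distance [2 * zeta i], and monotonicity requires
       a distance below [1/2]. *)
    assert (Bi : (2 * i + 1 = s)%Z -> zeta i < 1/4).
    { intros E'; generalize (Hzeta i); rewrite (Blast i Hi E'); lra. }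
    assert (Pe := bx _ Heta); assert (Pz := bx _ Hzeta).
    generalize (Pe (Z.abs (i - 1))) (Pz (Z.abs (i - 1))) (Pz i) (Pe (i + 1)%Z) (Pz (i + 1)%Z)
      (Hle (Z.abs (i - 1))) (Hle (i + 1)%Z).
    destruct Z.eq_dec as [E'|_]; [specialize (Bi E')|clear Bi]; intros;
      (apply defect_le; [assumption|lra..]).
  - intros i eta Hi Heta e1 He1.
    assert (Pe := bx _ Heta).
    assert (Bi : (2 * i + 1 = s)%Z -> eta i < 1/4).
    { intros E'; generalize (Heta i); rewrite (Blast i Hi E'); lra. }
    (* The next value is written [k + t * k'], linear in the moving entry [t]. *)
    set (k := if Z.eq_dec (2 * i + 1) s then 0 else eta (i + 1)%Z).
    set (k' := if Z.eq_dec (2 * i + 1) s then -1 else 0).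
    set (f := fun t => antichord_cos c (y + t * 1) (y + eta (Z.abs (i - 1)) + t * 0)
                     + antichord_cos c (y + t * 1) (y + k + t * k')).
    assert (Ff : forall t, F i (upd eta i t) = f t).
    { intros t; unfold F, f, k, k', next_value, upd.
      destruct (Z.eq_dec i i); [|tauto].
      destruct (Z.eq_dec (Z.abs (i - 1)) i); [destruct Hi; lia|].
      destruct (Z.eq_dec (i + 1) i); [lia|].
      destruct (Z.eq_dec (2 * i + 1) s); unfold defect; f_equal; f_equal; ring. }
    assert (Ff' : F i eta = f (eta i)).
    { unfold F, f, k, k', next_value.
      destruct (Z.eq_dec (2 * i + 1) s); unfold defect; f_equal; f_equal; ring. }
    assert (Cf : continuous f (eta i)).
    { apply @continuous_plus; apply antichord_cos_continuous; try assumption.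
      - generalize (Pe i) (Pe (Z.abs (i - 1))); intros; apply Rabs_def1; lra.
      - unfold k, k'; generalize (Pe i) (Pe (i + 1)%Z); intros.
        destruct Z.eq_dec as [E|E]; [assert (Q := Bi E)|]; apply Rabs_def1; lra. }
    destruct (continuous_eps f (eta i) Cf e1 He1) as (d & Hd & Kd).
    exists d; split; [assumption|]; intros t _ Ht; rewrite Ff, Ff'; now apply Kd.
  - intros i eta Hi Heta E; unfold F.
    assert (Pe := bx _ Heta).
    generalize (Pe (Z.abs (i - 1))) (Pe (i + 1)%Z); intros.
    unfold next_value; destruct (Z.eq_dec (2 * i + 1) s) as [Ei|Ei].
    (* The neighbours are at most [1/4] and [- b < 0], so [last_barrier] bounds the defect. *)
    + rewrite Blast in E by assumption; rewrite E.
      apply Rle_trans with (defect c y b (1/4) 0); [apply defect_le; [assumption|lra..]|].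
      unfold defect; rewrite Rplus_0_r; lra.
    + rewrite Bother in E by assumption; rewrite E.
      apply Rle_trans with (defect c y (1/4) (1/4) (1/4)); [apply defect_le; [assumption|lra..]|].
      unfold defect; rewrite (antichord_cos_quarter c rho) by assumption; lra.
  - exact sub.
  - assert (Pe := bx _ Hbox).
    assert (eta0 : forall i, ~ D i -> eta i = 0).
    { intros i Hi; generalize (Hbox i); rewrite m0, B0 by assumption; lra. }
    (* If one value is 1/4, strict monotonicity forces the next one to be 1/4 too, and so
       on up to the antisymmetry axis. *)
    assert (spread : forall i, D i -> eta i = 1/4 -> D (i + 1)%Z /\ eta (i + 1)%Z = 1/4).
    { intros i Hi E.
      assert (Ei : (2 * i + 1 <> s)%Z).
      { intros Ei; generalize (Hbox i); rewrite (Blast i Hi Ei); lra. }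
      assert (E' : eta (i + 1)%Z = 1/4).
      { assert (S := Hsol i Hi); unfold F, next_value, defect in S; rewrite E in S.
        destruct (Z.eq_dec (2 * i + 1) s) as [|_]; [tauto|].
        generalize (Pe (Z.abs (i - 1))) (Pe (i + 1)%Z); intros P1 P2.
        destruct P2 as [P2 [P3|P3]]; [|assumption].
        assert (antichord_cos c (y + 1/4) (y + eta (i + 1)%Z) <
                antichord_cos c (y + 1/4) (y + 1/4)) by (apply antichord_cos_lt; [assumption|lra..]).
        assert (antichord_cos c (y + 1/4) (y + eta (Z.abs (i - 1))) <=
                antichord_cos c (y + 1/4) (y + 1/4)) by (apply antichord_cos_le; [assumption|lra..]).
        rewrite (antichord_cos_quarter c rho) in * by assumption; lra. }
      split; [|assumption].
      destruct (Ddec (i + 1)%Z) as [Hd|Hd]; [assumption|].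
      rewrite (eta0 _ Hd) in E'; lra. }
    assert (never : forall n i, D i -> eta i = 1/4 -> D (i + Z.of_nat n)%Z /\ eta (i + Z.of_nat n)%Z = 1/4).
    { intros n i Hi E; induction n as [|n [IH1 IH2]].
      - now replace (i + Z.of_nat 0)%Z with i by lia.
      - replace (i + Z.of_nat (S n))%Z with (i + Z.of_nat n + 1)%Z by lia; now apply spread. }
    exists eta; repeat split.
    + generalize (Hbox i) (mpos i); unfold D; intuition lra.
    + destruct (Pe i) as [_ [L|L]]; [assumption|].
      (* After [s] steps the value [1/4] would have spread beyond [D]. *)
      destruct (never (Z.to_nat s) i) as [[_ N] _]; [now split|assumption|lia].
    + intros i Hi; apply eta0; unfold D; lia.
    + intros i H1' H2'; now apply Hsol.
Qed.

(** * Waves: even, s-antiperiodic sequences positive on the central half period *)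

Record wave (s : Z) (xi : Z -> R) : Prop := {
  wave_anti : forall i, xi (i + s)%Z = - xi i;
  wave_even : forall i, xi (- i)%Z = xi i;
  wave_range : forall i, (- s < 2 * i < s)%Z -> 0 < xi i < 1/4 }.

(** The indices from 0 to [s / 2] meet every orbit of the group generated by [i -> i + s] and
    [i -> - i]. *)
Lemma fold_ind (s : Z) (P : Z -> Prop) :
  (0 < s)%Z ->
  (forall i, P i -> P (i + s)%Z) -> (forall i, P i -> P (- i)%Z) ->
  (forall i, (0 <= i)%Z -> (2 * i <= s)%Z -> P i) -> forall i, P i.
Proof.
  intros Hs Hshift Hneg Hbase.
  assert (H : forall n : nat, forall i, (0 <= i <= Z.of_nat n)%Z -> P i).
  { induction n as [|n IH]; intros i Hi; [apply Hbase; lia|].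
    destruct (Z_le_dec (2 * i) s) as [Hle|Hgt]; [apply Hbase; lia|].
    replace i with (i - s + s)%Z by lia; apply Hshift.
    destruct (Z_le_dec 0 (i - s)); [apply IH; lia|].
    replace (i - s)%Z with (- (s - i))%Z by lia; apply Hneg, IH; lia. }
  intros i; destruct (Z_le_dec 0 i); [apply (H (Z.to_nat i)); lia|].
  rewrite <- (Z.opp_involutive i); apply Hneg, (H (Z.to_nat (- i))); lia.
Qed.

(** * Extension from half a period to all indices *)

Definition sgn (k : Z) : R := if Z.even k then 1 else -1.

(** For positive [s], [k * s] is the multiple of [s] nearest to [i], ties going up; each shift by
    [s] costs a sign. *)
Definition extend (s : Z) (eta : Z -> R) (i : Z) : R :=
  let k := ((2 * i + s) / (2 * s))%Z in sgn k * eta (Z.abs (i - k * s)).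

Lemma extend_eq (s : Z) (eta : Z -> R) (j k : Z) :
  (- s <= 2 * j < s)%Z -> extend s eta (j + k * s) = sgn k * eta (Z.abs j).
Proof.
  intros Hj; unfold extend.
  replace ((2 * (j + k * s) + s) / (2 * s))%Z with k.
  - now replace (j + k * s - k * s)%Z with j by lia.
  - apply Z.div_unique with (2 * j + s)%Z; lia.
Qed.

Lemma euclid_centred (s i : Z) :
  (0 < s)%Z -> exists j k, i = (j + k * s)%Z /\ (- s <= 2 * j < s)%Z.
Proof.
  intros Hs; exists (i - (2 * i + s) / (2 * s) * s)%Z, ((2 * i + s) / (2 * s))%Z.
  split; [lia|].
  generalize (Z.div_mod (2 * i + s) (2 * s)) (Z.mod_pos_bound (2 * i + s) (2 * s)); lia.
Qed.

Lemma extend_anti (s : Z) (eta : Z -> R) (i : Z) :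
  (0 < s)%Z -> extend s eta (i + s) = - extend s eta i.
Proof.
  intros Hs; destruct (euclid_centred s i Hs) as (j & k & -> & Hj).
  replace (j + k * s + s)%Z with (j + (k + 1) * s)%Z by lia.
  rewrite !extend_eq by assumption; unfold sgn.
  replace (Z.even (k + 1)) with (negb (Z.even k)) by (rewrite Z.even_add; now destruct (Z.even k)).
  destruct (Z.even k); simpl; ring.
Qed.

(** The window for [j] is half open, so its endpoint [- s / 2] has its mirror image outside; there
    both sides vanish because the node value is 0. *)
Lemma extend_even (s : Z) (eta : Z -> R) (i : Z) :
  (0 < s)%Z -> (forall j, (2 * j = s)%Z -> eta j = 0) ->
  extend s eta (- i) = extend s eta i.
Proof.
  intros Hs H0; destruct (euclid_centred s i Hs) as (j & k & -> & Hj).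
  destruct (Z.eq_dec (2 * j) (- s)) as [E|E].
  - replace (- (j + k * s))%Z with (j + (1 - k) * s)%Z by lia.
    rewrite !extend_eq, !H0 by lia; ring.
  - replace (- (j + k * s))%Z with (- j + (- k) * s)%Z by lia.
    rewrite !extend_eq by lia; unfold sgn.
    now rewrite Z.even_opp, Z.abs_opp.
Qed.

Lemma extend_id (s : Z) (eta : Z -> R) (i : Z) :
  (0 < s)%Z -> (forall j, (2 * j = s)%Z -> eta j = 0) ->
  (- s <= 2 * i <= s)%Z -> extend s eta i = eta (Z.abs i).
Proof.
  intros Hs H0 Hi.
  destruct (Z.eq_dec (2 * i) s) as [E|E].
  - replace i with (- i + 1 * s)%Z at 1 by lia; rewrite extend_eq, !H0 by lia; ring.
  - replace i with (i + 0 * s)%Z at 1 by lia; rewrite extend_eq by lia; unfold sgn; simpl; ring.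
Qed.

(** Negating all offsets is the reflection [rho]; this makes the recurrence compatible with
    antiperiodicity. *)
Lemma defect_opp (c : curve) (rho : D2) (y b a a' : R) :
  billiard_curve c -> centre c rho y ->
  defect c y (- b) (- a) (- a') = - defect c y b a a'.
Proof.
  intros Hc Hy; unfold defect.
  change (y + - b) with (y - b); change (y + - a) with (y - a); change (y + - a') with (y - a').
  rewrite !(antichord_cos_reflect c rho) by assumption; ring.
Qed.

Lemma defect_sym (c : curve) (y b a a' : R) : defect c y b a a' = defect c y b a' a.
Proof. apply Rplus_comm. Qed.

(** The recurrence respects both symmetries of the extension, so [fold_ind] leaves only the
    equations already solved and the one at the node. *)
Lemma wave_solution (c : curve) (rho : D2) (y : R) (s : Z) :
  billiard_curve c -> centre c rho y -> (2 <= s)%Z ->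
  curvature c y * pnorm (psub (gam c (y + 1/2)) (gam c y)) < 1 + cos (PI / IZR s) ->
  exists xi : Z -> R, wave s xi /\
    forall i, defect c y (xi i) (xi (i - 1)%Z) (xi (i + 1)%Z) = 0.
Proof.
  intros Hc Hy Hs Hk.
  destruct (half_period_solution c rho y s Hc Hy Hs Hk) as (eta & Hr & H0 & Hsol).
  assert (Hs0 : (0 < s)%Z) by lia.
  assert (H0' : forall j, (2 * j = s)%Z -> eta j = 0) by (intros; apply H0; lia).
  assert (Anti := fun i => extend_anti s eta i Hs0).
  assert (Even := fun i => extend_even s eta i Hs0 H0').
  assert (Id := fun i => extend_id s eta i Hs0 H0').
  set (xi := extend s eta) in *.
  exists xi; split; [split; try assumption|].
  - intros i Hi; rewrite Id by lia; apply Hr; lia.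
  - apply (fold_ind s); [assumption|..].
    + intros i Hi.
      replace (i + s - 1)%Z with (i - 1 + s)%Z by lia.
      replace (i + s + 1)%Z with (i + 1 + s)%Z by lia.
      rewrite !Anti, (defect_opp c rho), Hi by assumption; ring.
    + intros i Hi.
      replace (- i - 1)%Z with (- (i + 1))%Z by lia.
      replace (- i + 1)%Z with (- (i - 1))%Z by lia.
      now rewrite !Even, defect_sym.
    + intros i H1 H2; destruct (Z.eq_dec (2 * i) s) as [E|E].
      (* At the node the value is 0 and the neighbours are opposite, so the defect is its own
         negative. *)
      * replace (xi (i + 1)%Z) with (- xi (i - 1)%Z).
        { rewrite Id, Z.abs_eq, H0' by lia.
          generalize (defect_opp c rho y 0 (xi (i - 1)%Z) (- xi (i - 1)%Z) Hc Hy).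
          rewrite Ropp_0, Ropp_involutive, (defect_sym c y 0 (- _)); lra. }
        replace (i + 1)%Z with (- (i - 1) + s)%Z by lia; now rewrite Anti, Even.
      * replace (xi (i + 1)%Z) with (next_value s eta i).
        { rewrite !Id by lia; rewrite (Z.abs_eq i) by lia; apply Hsol; lia. }
        unfold next_value; destruct (Z.eq_dec (2 * i + 1) s) as [E'|E'].
        -- replace (i + 1)%Z with (- i + s)%Z by lia.
           rewrite Anti, Even, Id by lia; now rewrite Z.abs_eq by lia.
        -- rewrite Id, Z.abs_eq by lia; reflexivity.
Qed.

(** * Sign pattern of waves and its consequences *)

Lemma wave_period (s : Z) (xi : Z -> R) (i : Z) : wave s xi -> xi (i + 2 * s)%Z = xi i.
Proof.
  intros W; replace (i + 2 * s)%Z with (i + s + s)%Z by lia.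
  rewrite !(wave_anti s xi W); ring.
Qed.

Lemma wave_node (s : Z) (xi : Z -> R) (i : Z) : wave s xi -> (2 * i = s)%Z -> xi i = 0.
Proof.
  intros W E; generalize (wave_anti s xi W (- i)); rewrite (wave_even s xi W).
  replace (- i + s)%Z with i by lia; lra.
Qed.

Lemma wave_pos (s : Z) (xi : Z -> R) (i : Z) : wave s xi -> (- s < 2 * i < s)%Z -> 0 < xi i.
Proof. intros W Hi; now apply (wave_range s xi W). Qed.

Lemma wave_neg (s : Z) (xi : Z -> R) (i : Z) :
  wave s xi -> (s < 2 * i < 3 * s)%Z -> xi i < 0.
Proof.
  intros W Hi; replace i with (i - s + s)%Z by lia; rewrite (wave_anti s xi W).
  assert (0 < xi (i - s)%Z) by (apply (wave_pos s); [assumption|lia]); lra.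
Qed.

Lemma wave_node_opp (s : Z) (xi : Z -> R) (i : Z) : wave s xi -> (2 * i = 3 * s)%Z -> xi i = 0.
Proof.
  intros W E; replace i with (i - s + s)%Z by lia; rewrite (wave_anti s xi W).
  rewrite (wave_node s xi _ W); [ring|lia].
Qed.

Lemma wave_bound (s : Z) (xi : Z -> R) (i : Z) :
  (0 < s)%Z -> wave s xi -> - (1/4) < xi i < 1/4.
Proof.
  intros Hs W; revert i; apply (fold_ind s); [assumption|..]; intros i.
  - rewrite (wave_anti s xi W); lra.
  - now rewrite (wave_even s xi W).
  - intros H1 H2; destruct (Z.eq_dec (2 * i) s) as [E|E].
    + rewrite (wave_node s xi i W E); lra.
    + generalize (wave_range s xi W i); intros K; destruct K; [lia|lra].
Qed.

(** Reduce [k] modulo [2 * s] to [r]. For nonzero [r], one of the positive entries at 0, [n] and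
    [- n], with [n] the last index below [s / 2], would be moved onto a nonpositive one. *)
Lemma wave_translation (s k : Z) (xi : Z -> R) :
  (0 < s)%Z -> wave s xi -> (forall i, xi (i + k)%Z = xi i) -> exists q, (k = 2 * s * q)%Z.
Proof.
  intros Hs W Hk.
  assert (Hq : forall q i, xi (i + 2 * s * q)%Z = xi i).
  { induction q using Z.peano_ind; intros i.
    - f_equal; lia.
    - rewrite <- (IHq i), <- (wave_period s xi (i + 2 * s * q) W); f_equal; lia.
    - rewrite <- (IHq i), <- (wave_period s xi (i + 2 * s * Z.pred q) W).
      f_equal; lia. }
  exists (k / (2 * s))%Z.
  assert (E := Z.div_mod k (2 * s) ltac:(lia)).
  assert (Br := Z.mod_pos_bound k (2 * s) ltac:(lia)).
  set (q := (k / (2 * s))%Z) in *; set (r := (k mod (2 * s))%Z) in *.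
  assert (Hr : forall i, xi (i + r)%Z = xi i).
  { intros i; rewrite <- (Hq q (i + r)%Z), <- (Hk i); f_equal; lia. }
  clearbody q r; destruct (Z.eq_dec r 0) as [->|Hr0]; [lia|exfalso].
  assert (P0 : 0 < xi 0%Z) by (apply (wave_pos s); [assumption|lia]).
  assert (Hr' := Hr 0%Z); rewrite Z.add_0_l in Hr'.
  set (n := ((s - 1) / 2)%Z).
  assert (Hn : (s - 2 <= 2 * n < s)%Z).
  { unfold n; generalize (Z.div_mod (s - 1) 2) (Z.mod_pos_bound (s - 1) 2); lia. }
  clearbody n.
  assert (NP : forall i, (s <= 2 * i <= 3 * s)%Z -> xi i <= 0).
  { intros i Hi; destruct (Z.eq_dec (2 * i) s) as [Ei|Ei]; [rewrite (wave_node s xi _ W Ei); lra|].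
    destruct (Z.eq_dec (2 * i) (3 * s)) as [Ej|Ej]; [rewrite (wave_node_opp s xi _ W Ej); lra|].
    left; apply (wave_neg s); [assumption|lia]. }
  assert (Pn : 0 < xi n) by (apply (wave_pos s); [assumption|lia]).
  destruct (Z_lt_dec (2 * r) s) as [H1|H1].
  - generalize (NP (n + r)%Z); rewrite Hr; intros K.
    assert (xi n <= 0) by (apply K; lia); lra.
  - destruct (Z_lt_dec (3 * s) (2 * r)) as [H2|H2].
    + generalize (NP (- n + r)%Z); rewrite Hr, (wave_even s xi W); intros K.
      assert (xi n <= 0) by (apply K; lia); lra.
    + assert (xi r <= 0) by (apply NP; lia); lra.
Qed.

Lemma wave_two_sign_changes (s : Z) (xi : Z -> R) :
  (0 < s)%Z -> wave s xi -> two_sign_changes xi (2 * s).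
Proof.
  intros Hs W.
  set (n := ((s - 1) / 2)%Z).
  assert (Hn : (s - 2 <= 2 * n < s)%Z).
  { unfold n; generalize (Z.div_mod (s - 1) 2) (Z.mod_pos_bound (s - 1) 2); lia. }
  clearbody n.
  assert (P : forall i, (- s < 2 * i < s)%Z -> 0 < xi i) by (intros; now apply (wave_pos s)).
  assert (N : forall i, (s < 2 * i < 3 * s)%Z -> xi i < 0) by (intros; now apply (wave_neg s)).
  assert (P' : forall i, (3 * s < 2 * i < 5 * s)%Z -> 0 < xi i).
  { intros i Hi; replace i with (i - 2 * s + 2 * s)%Z by lia.
    rewrite (wave_period s xi _ W); apply P; lia. }
  assert (Same : forall i, 0 < xi i * xi (i + 1)%Z -> ~ sign_change_at xi i).
  { intros i H (H1 & j & H2 & H3 & H4).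
    destruct (Z.eq_dec j (i + 1)) as [->|Hj]; [lra|].
    rewrite (H4 (i + 1)%Z) in H by lia; lra. }
  exists n, (n + s)%Z; repeat split; try lia.
  - generalize (P n); intros K; specialize (K ltac:(lia)); lra.
  (* For even [s] the next index is the node, a zero that the sign change must jump over. *)
  - destruct (Z.eq_dec (2 * n + 2) s) as [E|E].
    + exists (n + 2)%Z; repeat split; try lia.
      * generalize (P n ltac:(lia)) (N (n + 2)%Z); intros K1 K2.
        destruct (Z.eq_dec s 1); [lia|]; specialize (K2 ltac:(lia)); nra.
      * intros k Hk; apply (wave_node s); [assumption|lia].
    + exists (n + 1)%Z; repeat split; try lia.
      generalize (P n ltac:(lia)) (N (n + 1)%Z ltac:(lia)); nra.
  - generalize (N (n + s)%Z ltac:(lia)); lra.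
  - destruct (Z.eq_dec (2 * n + 2) s) as [E|E].
    + exists (n + s + 2)%Z; repeat split; try lia.
      * generalize (N (n + s)%Z ltac:(lia)) (P' (n + s + 2)%Z ltac:(lia)); nra.
      * intros k Hk; apply (wave_node_opp s); [assumption|lia].
    + exists (n + s + 1)%Z; repeat split; try lia.
      generalize (N (n + s)%Z ltac:(lia)) (P' (n + s + 1)%Z ltac:(lia)); nra.
  - intros i Hi Hc.
    destruct (Z.eq_dec i n) as [|E1]; [now left|].
    destruct (Z.eq_dec i (n + s)) as [|E2]; [now right|exfalso].
    destruct (Z.eq_dec (2 * i) s) as [E3|E3].
    { destruct Hc as [Hc _]; apply Hc; now apply (wave_node s). }
    destruct (Z.eq_dec (2 * i) (3 * s)) as [E4|E4].
    { destruct Hc as [Hc _]; apply Hc; now apply (wave_node_opp s). }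
    revert Hc; apply Same.
    destruct (Z_lt_dec (2 * i) s); [|destruct (Z_lt_dec (2 * i) (3 * s))].
    + generalize (P i ltac:(lia)) (P (i + 1)%Z ltac:(lia)); nra.
    + generalize (N i ltac:(lia)) (N (i + 1)%Z ltac:(lia)); nra.
    + generalize (P' i ltac:(lia)) (P' (i + 1)%Z ltac:(lia)); nra.
Qed.

Lemma steps_of_two (f : Z -> R) (n : nat) (i : Z) :
  (forall j, f j <= f (j + 2)%Z) -> f i <= f (i + 2 * Z.of_nat n)%Z.
Proof.
  intros H; induction n as [|n IH]; [right; f_equal; lia|].
  apply Rle_trans with (1 := IH).
  replace (i + 2 * Z.of_nat (S n))%Z with (i + 2 * Z.of_nat n + 2)%Z by lia; apply H.
Qed.

(** For [x i = y + xi i + i / 2], comparing [x (i + 2)] with [x i + 1] compares [xi (i + 2)] with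
    [xi i]; the Birkhoff property would give that comparison the same direction for all [i]. *)
Lemma wave_not_monotone (s : Z) (xi : Z -> R) :
  (2 <= s)%Z -> wave s xi ->
  ~ (forall i, xi i <= xi (i + 2)%Z) /\ ~ (forall i, xi (i + 2)%Z <= xi i).
Proof.
  intros Hs W.
  (* [j] is a positive entry of the parity of [s], so that it is joined to [s] by steps of
     two, and [s] to the translate [2 s - j] of its mirror image. *)
  set (j := (s mod 2)%Z).
  assert (Hj : (s = 2 * (s / 2) + j)%Z) by (apply Z.div_mod; lia).
  assert (Hj2 : (0 <= j < 2)%Z) by (apply Z.mod_pos_bound; lia).
  set (h := (s / 2)%Z) in *; clearbody j h.
  assert (Pj : 0 < xi j) by (apply (wave_pos s); [assumption|lia]).
  assert (Ns : xi s < 0) by (apply (wave_neg s); [assumption|lia]).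
  assert (Pj' : xi (2 * s - j)%Z = xi j).
  { replace (2 * s - j)%Z with (- j + 2 * s)%Z by lia.
    now rewrite (wave_period s xi _ W), (wave_even s xi W). }
  split; intros H.
  - assert (K := steps_of_two xi (Z.to_nat h) j H).
    replace (j + 2 * Z.of_nat (Z.to_nat h))%Z with s in K by lia; lra.
  - assert (K := steps_of_two (fun i => - xi i) (Z.to_nat h) s).
    cbv beta in K; replace (s + 2 * Z.of_nat (Z.to_nat h))%Z with (2 * s - j)%Z in K by lia.
    assert (- xi s <= - xi (2 * s - j)%Z); [|lra].
    apply K; intros i; generalize (H i); lra.
Qed.

(** * The orbit *)

(** [D2R] fixes no point of the curve, so it swaps the two points of the orbit and the lift advances
    by exactly [1/2]. [D2S] either fixes the first point or swaps it with its antipode, and in the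
    latter case [D2RS] fixes it. *)
Lemma symmetric_orbit_centre (c : curve) (X : Z -> R) :
  billiard_curve c -> lift_seq X ->
  (forall i : Z, traj c X (i + 2)%Z = traj c X i) -> D2_symmetric (traj c X) ->
  (forall i, X i = X 0%Z + IZR i / 2) /\ exists rho, centre c rho (X 0%Z).
Proof.
  intros Hc Hl H2 Hsym.
  assert (Per : forall k i, traj c X (i + 2 * k)%Z = traj c X i).
  { induction k using Z.peano_ind; intros i.
    - f_equal; lia.
    - rewrite <- (IHk i), <- (H2 (i + 2 * k)%Z); f_equal; lia.
    - rewrite <- (IHk i), <- (H2 (i + 2 * Z.pred k)%Z); f_equal; lia. }
  assert (Par : forall k, traj c X k = traj c X 0%Z \/ traj c X k = traj c X 1%Z).
  { intros k; assert (E := Z.div_mod k 2 ltac:(lia)).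
    assert (B := Z.mod_pos_bound k 2 ltac:(lia)).
    rewrite E, Z.add_comm, Per.
    assert ((k mod 2 = 0)%Z \/ (k mod 2 = 1)%Z) as [-> | ->] by lia; tauto. }
  assert (Orb : forall h, act h (traj c X 0%Z) = traj c X 0%Z \/
      act h (traj c X 0%Z) = traj c X 1%Z).
  { intros h; destruct (Hsym h) as [k [K|K]]; rewrite K; apply Par. }
  assert (Hno : forall x, act D2R (gam c x) <> gam c x).
  { intros x E; rewrite <- gam_half in E by assumption; symmetry in E.
    apply gam_inj in E; [|assumption]; destruct E as [n Hn].
    assert (0 < IZR n < 1) as [N0 N1] by lra.
    apply lt_IZR in N0; apply lt_IZR in N1; lia. }
  assert (R01 : act D2R (traj c X 0%Z) = traj c X 1%Z).
  { destruct (Orb D2R) as [E|E]; [now apply Hno in E|assumption]. }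
  assert (RR : forall u, act D2R (act D2R u) = u).
  { intros [u1 u2]; simpl; f_equal; ring. }
  assert (Hstep : forall i, X (i + 1)%Z = X i + 1/2).
  { intros i.
    assert (E : gam c (X (i + 1)%Z) = gam c (X i + 1/2)).
    { rewrite gam_half by assumption.
      change (traj c X (i + 1)%Z = act D2R (traj c X i)).
      assert (E := Z.div_mod i 2 ltac:(lia)).
      assert (B := Z.mod_pos_bound i 2 ltac:(lia)).
      set (q := (i / 2)%Z) in *; set (r := (i mod 2)%Z) in *; clearbody q r; subst i.
      replace (2 * q + r + 1)%Z with (r + 1 + 2 * q)%Z by lia.
      replace (2 * q + r)%Z with (r + 2 * q)%Z by lia.
      rewrite !Per; assert (r = 0 \/ r = 1)%Z as [-> | ->] by lia; [now symmetry|].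
      rewrite <- R01, RR; apply (H2 0%Z). }
    symmetry in E; apply gam_inj in E; [|assumption]; destruct E as [n Hn].
    destruct (Hl i) as [L1 L2].
    assert (-1 < IZR n < 1) as [N0 N1] by lra.
    apply lt_IZR in N0; apply lt_IZR in N1; assert (n = 0)%Z by lia; subst n; lra. }
  split.
  - induction i using Z.peano_ind; [lra| |].
    + rewrite succ_IZR; replace (Z.succ i) with (i + 1)%Z by lia; rewrite Hstep; lra.
    + unfold Z.pred; rewrite plus_IZR; generalize (Hstep (i + -1)%Z).
      replace (i + -1 + 1)%Z with i by lia; lra.
  - assert (HS : forall x, gam c (- x) = act D2S (gam c x)) by apply Hc.
    assert (E1 : traj c X 1%Z = gam c (X 0%Z + 1/2)).
    { unfold traj; f_equal; rewrite <- Hstep; reflexivity. }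
    destruct (Orb D2S) as [E|E].
    + exists D2S; split; [tauto|]; intros a.
      unfold traj in E; rewrite <- HS in E; symmetry in E.
      apply gam_inj in E; [|assumption]; destruct E as [n Hn].
      rewrite <- HS, <- (gam_IZR c _ n) by assumption; f_equal; lra.
    + exists D2RS; split; [tauto|]; intros a.
      rewrite E1 in E; unfold traj in E; rewrite <- HS in E; symmetry in E.
      apply gam_inj in E; [|assumption]; destruct E as [n Hn].
      transitivity (act D2R (act D2S (gam c (X 0%Z + a)))); [|simpl; f_equal; ring].
      rewrite <- HS, <- gam_half, <- (gam_IZR c (X 0%Z - a) (n + 1)) by assumption.
      f_equal; rewrite plus_IZR; lra.
Qed.

(** Shifting both points by half turns applies one common isometry; this makes the recurrence
    autonomous. *)
Lemma antichord_cos_halves (c : curve) (y x : R) (n : Z) :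
  billiard_curve c ->
  antichord_cos c (y + IZR n / 2) (x + IZR n / 2) = antichord_cos c y x.
Proof.
  intros Hc; unfold antichord_cos.
  rewrite !gam_halves, tangent_halves by assumption.
  destruct (Z.even n); [reflexivity|].
  rewrite padd_act, unitv_act; apply dot_act.
Qed.

(** The next bounce [v + 1/2] and the previous one [w - 1/2] are antipodes of [v] and [w], so both
    chords are antichords up to sign. *)
Lemma reflection_law_defect (c : curve) (u v w : R) :
  billiard_curve c ->
  dot (psub (unitv (psub (gam c (v + 1/2)) (gam c u)))
            (unitv (psub (gam c u) (gam c (w - 1/2))))) (tangent c u)
  = - (antichord_cos c u w + antichord_cos c u v).
Proof.
  intros Hc.
  assert (W : gam c (w - 1/2) = act D2R (gam c w)).
  { rewrite <- gam_half, <- (gam_IZR c (w - 1/2) 1) by assumption; f_equal; lra. }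
  rewrite W, gam_half by assumption.
  replace (psub (act D2R (gam c v)) (gam c u)) with (act D2R (padd (gam c u) (gam c v)))
    by (unfold psub, padd; simpl; f_equal; ring).
  replace (psub (gam c u) (act D2R (gam c w))) with (padd (gam c u) (gam c w))
    by (unfold psub, padd; simpl; f_equal; ring).
  rewrite unitv_act; unfold antichord_cos, psub, dot; simpl; ring.
Qed.

(** Equal points make [2 * (b - a)] an integer, and it lies strictly between -1 and 1; its vanishing
    also settles the parity. *)
Lemma gam_halves_inj (c : curve) (y a b : R) (i j : Z) :
  billiard_curve c -> Rabs (b - a) < 1/2 ->
  gam c (y + a + IZR i / 2) = gam c (y + b + IZR j / 2) -> a = b /\ Z.Even (j - i).
Proof.
  intros Hc Hab E; apply gam_inj in E; [|assumption]; destruct E as [n Hn].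
  apply Rabs_def2 in Hab.
  assert (K : IZR (2 * n + i - j) = 2 * (b - a)).
  { rewrite minus_IZR, plus_IZR, mult_IZR; lra. }
  assert (-1 < IZR (2 * n + i - j) < 1) as [K1 K2] by lra.
  apply lt_IZR in K1; apply lt_IZR in K2.
  assert (K0 : (2 * n + i - j = 0)%Z) by lia; rewrite K0 in K.
  split; [lra|exists n; lia].
Qed.

Lemma act_R_halves (c : curve) (x : R) (i : Z) :
  billiard_curve c -> act D2R (gam c (x + IZR i / 2)) = gam c (x + IZR (i + 1) / 2).
Proof.
  intros Hc; rewrite <- gam_half by assumption.
      f_equal; rewrite plus_IZR; lra.
Qed.

Lemma act_centre_halves (c : curve) (rho : D2) (y a : R) (i : Z) :
  billiard_curve c -> centre c rho y ->
  act rho (gam c (y + a + IZR i / 2)) = gam c (y + - a + IZR i / 2).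
Proof.
  intros Hc [_ Hy]; rewrite Rplus_assoc, <- Hy, <- (gam_IZR c _ i) by assumption; f_equal; lra.
Qed.

Theorem mainTheorem3 (c : curve) (X : Z -> R) (s : Z) :
  billiard_curve c ->
  billiard_orbit c X ->
  (forall i : Z, traj c X (i + 2)%Z = traj c X i) ->
  Birkhoff X ->
  D2_symmetric (traj c X) ->
  (2 <= s)%Z ->
  curvature c (X 0%Z) * pnorm (psub (traj c X 1%Z) (traj c X 0%Z))
    < 2 * (cos (PI / IZR (2 * s))) ^ 2 ->
  exists x : Z -> R,
    billiard_orbit c x /\
    inX (2 * s) s x /\
    minimal_period (traj c x) (2 * s) /\
    ~ Birkhoff x /\
    exists sigma : D2, (sigma = D2S \/ sigma = D2RS) /\
      (forall h : D2, inH (traj c x) h <-> h = D2id \/ h = sigma) /\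
      (forall i : Z, act sigma (traj c x i) = traj c x (s + i)%Z) /\
      (exists k : Z, forall i : Z, act sigma (traj c x i) = traj c x (k - i)%Z) /\
      exists n : Z, inX (2 * s) s (fun i => X i + IZR n) /\
        two_sign_changes (fun i => x i - (X i + IZR n)) (2 * s).
Proof.
  intros Hc [Hl _] H2 _ Hsym Hs Hk.
  destruct (symmetric_orbit_centre c X Hc Hl H2 Hsym) as [HX [rho Hy]].
  unfold traj in Hk; rewrite (HX 1%Z) in Hk.
  set (y := X 0%Z) in *.
  assert (Hs0 : (0 < s)%Z) by lia.
  (* Double angle formula for [PI / (2 s)]. *)
  assert (Hk' : curvature c y * pnorm (psub (gam c (y + 1/2)) (gam c y)) < 1 + cos (PI / IZR s)).
  { replace (PI / IZR s) with (2 * (PI / IZR (2 * s))).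
    - rewrite cos_2a_cos; lra.
    - rewrite mult_IZR; assert (0 < IZR s) by (now apply IZR_lt); field; lra. }
  destruct (wave_solution c rho y s Hc Hy Hs Hk') as (xi & W & Hxi).
  assert (Bd := fun i => wave_bound s xi i Hs0 W).
  assert (Bd2 : forall i j, Rabs (xi j - xi i) < 1/2).
  { intros i j; generalize (Bd i) (Bd j); intros; apply Rabs_def1; lra. }
  set (x := fun i => y + xi i + IZR i / 2).
  assert (Tr : forall i, traj c x i = gam c (y + xi i + IZR i / 2)) by reflexivity.
  assert (Hinj : forall i j k l, gam c (y + xi i + IZR k / 2) = gam c (y + xi j + IZR l / 2) ->
     xi i = xi j /\ Z.Even (l - k)).
  { intros i j k l; apply gam_halves_inj; [assumption|apply Bd2]. }
  (* Shifting time by [s] negates the offset, which is [rho], and adds [s] half turns, which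
     contribute [D2R] when [s] is odd. *)
  set (sigma := if Z.even s then rho else match rho with D2S => D2RS | _ => D2S end).
  assert (Hsig : sigma = D2S \/ sigma = D2RS).
  { destruct Hy as [[E|E] _]; unfold sigma; rewrite E; destruct (Z.even s); tauto. }
  assert (Hact : forall i, act sigma (traj c x i) = traj c x (s + i)%Z).
  { intros i; rewrite !Tr, Z.add_comm, (wave_anti s xi W), plus_IZR.
    replace (y + - xi i + (IZR i + IZR s) / 2) with (y + - xi i + IZR i / 2 + IZR s / 2) by lra.
    rewrite (gam_halves c _ s), <- (act_centre_halves c rho) by assumption.
    unfold sigma; destruct (Z.even s); [reflexivity|].
    destruct Hy as [[E|E] _]; rewrite E; simpl; f_equal; ring. }
  (* By evenness of [xi] the lifts at [s + i] and [s - i] differ by the integer [i]; with [Hact]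
     this makes [sigma] time-reversing as well. *)
  assert (Hsi : forall i, traj c x (s - i)%Z = traj c x (s + i)%Z).
  { intros i; rewrite !Tr.
    replace (s - i)%Z with (- i + s)%Z by lia; replace (s + i)%Z with (i + s)%Z by lia.
    rewrite !(wave_anti s xi W), (wave_even s xi W), <- (gam_IZR c _ i) by assumption.
    f_equal; rewrite !plus_IZR, opp_IZR; lra. }
  assert (Hss : forall u, act sigma (act sigma u) = u).
  { intros [u1 u2]; destruct Hsig as [-> | ->]; simpl; f_equal; ring. }
  (* [D2R] adds one half turn, so, up to evenness, it would make [xi] invariant under an odd
     translation, whereas all its translations are multiples of [2 * s]. *)
  assert (HnoR : ~ inH (traj c x) D2R).
  { assert (T : forall k, Z.Odd k -> (forall i, xi (i + k)%Z = xi i) -> False).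
    { intros k [m ->] H; destruct (wave_translation s _ xi Hs0 W H) as [q Hq]; lia. }
    intros [k [K|K]].
    - apply (T k).
      + generalize (K 0%Z); rewrite !Tr, act_R_halves by assumption; intros E.
        apply Hinj in E; destruct E as [_ [m Hm]]; exists m; lia.
      + intros i; generalize (K i); rewrite !Tr, act_R_halves by assumption; intros E.
        apply Hinj in E; destruct E as [E _]; rewrite E; f_equal; lia.
    - apply (T (- k)%Z).
      + generalize (K 0%Z); rewrite !Tr, act_R_halves by assumption; intros E.
        apply Hinj in E; destruct E as [_ [m Hm]]; exists (- m - 1)%Z; lia.
      + intros i; generalize (K i); rewrite !Tr, act_R_halves by assumption; intros E.
        apply Hinj in E; destruct E as [E _]; rewrite E, <- (wave_even s xi W); f_equal; lia. }
  exists x; split; [|split; [|split; [|split]]].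
  - split.
    + intros i; unfold x; rewrite plus_IZR; generalize (Bd i) (Bd (i + 1)%Z); lra.
    + intros i.
      replace (x (i + 1)%Z) with (y + xi (i + 1)%Z + IZR i / 2 + 1/2)
        by (unfold x; rewrite plus_IZR; lra).
      replace (x (i - 1)%Z) with (y + xi (i - 1)%Z + IZR i / 2 - 1/2)
        by (unfold x; rewrite minus_IZR; lra).
      rewrite reflection_law_defect by assumption; unfold x.
      rewrite !antichord_cos_halves by assumption.
      generalize (Hxi i); unfold defect; lra.
  - intros i; unfold x; rewrite (wave_period s xi _ W), plus_IZR, mult_IZR; lra.
  - split; [lia|split].
    + intros i; rewrite !Tr, (wave_period s xi _ W), <- (gam_IZR c (y + xi i + IZR i / 2) s)
        by assumption.
      f_equal; rewrite plus_IZR, mult_IZR; lra.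
    + intros m Hm H.
      destruct (wave_translation s m xi Hs0 W) as [q Hq]; [|destruct (Z_le_dec q 0); nia].
      intros i; now apply (Hinj _ _ (i + m)%Z i), H.
  - intros HB.
    destruct (wave_not_monotone s xi Hs W) as [N1 N2].
    (* Whichever way [x 2] compares with [x 0 + 1], the Birkhoff property carries the comparison to
       all indices. *)
    destruct (Rle_dec (x 0%Z + IZR 1) (x 2%Z)) as [H|H].
    + apply N1; intros i; assert (H' : x 0%Z <= x 2%Z + IZR (-1)) by lra.
      apply (HB _ _ _ i) in H'; revert H'; unfold x.
      rewrite Z.add_0_l, (Z.add_comm 2), plus_IZR; lra.
    + apply N2; intros i; assert (H' : x 2%Z <= x 0%Z + IZR 1) by lra.
      apply (HB _ _ _ i) in H'; revert H'; unfold x.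
      rewrite Z.add_0_l, (Z.add_comm 2), plus_IZR; lra.
  - exists sigma; split; [assumption|split; [|split; [assumption|split]]].
    + intros h; split.
      * intros [k K].
        (* If the other reflection, [sigma] times [D2R], were a symmetry, composing with [sigma]
           would make [D2R] one. *)
        assert (HR : (forall u, act h u = act sigma (act D2R u)) -> False).
        { intros E; apply HnoR; destruct K as [K|K]; [exists (s + k)%Z; left|exists (s + k)%Z; right];
            intros i; rewrite <- (Hss (act D2R _)), <- E, K, Hact; f_equal; lia. }
        destruct h; [now left| | | ].
        -- elim HnoR; now exists k.
        -- destruct Hsig as [E|E]; [right; now rewrite E|].
           elim HR; intros u; rewrite E; simpl; f_equal; ring.
        -- destruct Hsig as [E|E]; [|right; now rewrite E].
           elim HR; intros u; rewrite E; simpl; f_equal; ring.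
      * intros [-> | ->]; [exists 0%Z; left; intros i; reflexivity|exists s; now left].
    + exists s; intros i; now rewrite Hsi.
    (* The given lift already serves: [x - X] is [xi]. *)
    + exists 0%Z; split.
      * intros i; rewrite (HX (i + _)%Z), (HX i), plus_IZR, mult_IZR; lra.
      * apply wave_two_sign_changes; [assumption|].
        assert (E : forall i, x i - (X i + IZR 0) = xi i) by (intros i; rewrite HX; unfold x; lra).
        split; intros i; rewrite !E; apply W.
Qed.
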